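(* Let $\mathscr{P}=(\mathcal{P}_1,\ldots,\mathcal{P}_n)$ be a collection of $n$ convex integral polytopes in $(\mathbb{R}_{\ge0})^n$ and $\mathscr{S}$ a collection of subsets of $[n]$. Let $\mathcal{T}=\{I\subseteq[n]:I\notin\overline{\mathscr{S}},\ \mathscr{P}\text{ is }(\mathbb{K}^* )^I\text{-exotrivial}\}$, $\mathcal{T}'=\{I\subseteq[n]:I\notin\overline{\mathscr{S}},\ \mathscr{P}\text{ is not }(\mathbb{K}^* )^I\text{-exotrivial}\}$, $\mathcal{T}^*=\{I\in\mathcal{T}:|\mathcal{N}^I_{\mathscr{P}}|=|I|\}$, and $\mathcal{N}_{\mathscr{S},\mathscr{P}}=\{I\in\mathcal{T}':\mathscr{P}\text{ is not }(\mathbb{K}^* )^I\text{-trivial}\}$. Let $f_1,\ldots,f_n\in\mathbb{K}[x_1,\ldots,x_n]$. Then the following are equivalent: (1) $f_1,\ldots,f_n$ are $\mathscr{P}$-non-degenerate on $\mathbb{K}^n_{\overline{\mathscr{S}}}$, i.e. they satisfy: (a) they are $\mathscr{P}$-admissible; (b) for all $I\in\mathcal{T}'$, $f_1|_{\mathbb{K}^I},\ldots,f_n|_{\mathbb{K}^I}$ are BKK non-degenerate both at infinity and at $(\overline{\mathscr{S}}\cup\mathcal{T})^I$; (c) for all $I\in\mathcal{T}$, $f_1|_{\mathbb{K}^I},\ldots,f_n|_{\mathbb{K}^I}$ are BKK non-degenerate at $\mathcal{T}'^I$. (2) The following three conditions hold: (i) $f_1,\ldots,f_n$ are $\mathscr{P}$-admissible;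 (ii) for all $I\in\mathcal{N}_{\mathscr{S},\mathscr{P}}$, $f_1|_{\mathbb{K}^I},\ldots,f_n|_{\mathbb{K}^I}$ are BKK non-degenerate both at infinity and at $(\overline{\mathscr{S}}\cup\mathcal{T})^I$; (iii) for all $I\in\mathcal{T}^*$, $f_1|_{\mathbb{K}^I},\ldots,f_n|_{\mathbb{K}^I}$ are BKK non-degenerate at $\mathcal{T}'^I$.
   Context: $\mathbb{K}$ is an algebraically closed field of arbitrary characteristic, $n\ge1$, $[n]=\{1,\ldots,n\}$. For $I\subseteq[n]$: $\mathbb{K}^I=\{x\in\mathbb{K}^n:x_i=0\text{ for }i\notin I\}$, $(\mathbb{K}^* )^I=\{x\in\mathbb{K}^I:x_i\ne0\text{ for }i\in I\}$, $\mathbb{R}^I$ is defined like $\mathbb{K}^I$, $\mathcal{P}^I=\mathcal{P}\cap\mathbb{R}^I$; $f|_{\mathbb{K}^I}\in\mathbb{K}[x_i:i\in I]$ is $f$ with $x_i=0$ for $i\notin I$. $\overline{\mathscr{S}}=\{J\subseteq[n]:J\subseteq S\text{ for some }S\in\mathscr{S}\}$, $\mathbb{K}^n_{\overline{\mathscr{S}}}=\mathbb{K}^n\setminus\bigcup_{S\in\overline{\mathscr{S}}}(\mathbb{K}^* )^S$; for a collection $\mathscr{R}$ of subsets of $[n]$, $\mathscr{R}^I=\{S\in\mathscr{R}:S\subseteq I\}$. $f_1,\ldots,f_n$ are $\mathscr{P}$-admissible if the Newton polytope (convex hull of the support) of $f_j$ is $\mathcal{P}_j$ for each $j$. $\mathscr{P}$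 is $(\mathbb{K}^* )^I$-trivial if $V(g_1,\ldots,g_n)\cap(\mathbb{K}^* )^I=\emptyset$ for generic $\mathscr{P}$-admissible $g_1,\ldots,g_n$. $\mathcal{N}^I_{\mathscr{P}}=\{j:\mathcal{P}_j^I\ne\emptyset\}$; $\mathcal{E}_{\mathscr{P}}=\{I\subseteq[n]:\text{there is }\tilde I\supseteq I\text{ with }|\mathcal{N}^{\tilde I}_{\mathscr{P}}|<|\tilde I|\}$. $\mathscr{P}$ is $(\mathbb{K}^* )^I$-exotrivial if either $I\in\mathcal{E}_{\mathscr{P}}$, or $\mathscr{P}$ is $(\mathbb{K}^* )^I$-trivial and there is $\tilde I\supseteq I$ such that $\mathscr{P}$ is $(\mathbb{K}^* )^{\tilde I}$-trivial, $|\mathcal{N}^{\tilde I}_{\mathscr{P}}|=|\tilde I|$, and $|\mathcal{N}^{I^*}_{\mathscr{P}}|>|I^*|$ for each $I^*$ with $I\subseteq I^*\subsetneq\tilde I$. A weighted degree $\omega$ on $\mathbb{K}[x_i:i\in I]$ centered at infinity is given by integer weights $(\omega_i)_{i\in I}$ with gcd $1$ and at least one $\omega_i>0$; $\mathrm{Ld}_\omega(g)$ is the sum of the terms of $g$ of maximal $\omega$-weight. A monomial valuation $\nu$ on $\mathbb{K}[x_i:i\in I]$ is given by integer weights $(\nu_i)_{i\in I}$, all zero or with gcd $1$; $\mathrm{In}_\nu(g)$ is the sum of the terms of $g$ of minimal $\nu$-weight ($\mathrm{In}_\nu(0)=\mathrm{Ld}_\omega(0)=0$). Polynomials $g_1,\ldots,g_m\in\mathbb{K}[x_i:i\in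 I]$ are BKK non-degenerate at infinity if for every weighted degree $\omega$ centered at infinity, $\mathrm{Ld}_\omega(g_1),\ldots,\mathrm{Ld}_\omega(g_m)$ have no common zero in $(\mathbb{K}^* )^n$. For a collection $\mathscr{R}$ of subsets of $I$, they are BKK non-degenerate at $\mathscr{R}$ if $\mathrm{In}_\nu(g_1),\ldots,\mathrm{In}_\nu(g_m)$ have no common zero in $(\mathbb{K}^* )^n$ for every monomial valuation $\nu$ on $\mathbb{K}[x_i:i\in I]$ for which there is $S\in\mathscr{R}$ with $\nu_s=0$ for $s\in S$ and $\nu_s>0$ for $s\in I\setminus S$. *)

(* Defs.v *)
From HB Require Import structures.
From mathcomp Require Import all_boot all_order all_algebra.
From mathcomp Require Import boolp classical_sets reals.
From mathcomp Require Import mpoly.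

Set Implicit Arguments.
Unset Strict Implicit.
Unset Printing Implicit Defensive.

Import Order.TTheory GRing.Theory Num.Theory.
Local Open Scope ring_scope.

Section Polytopes.
Context {R : realType} {n : nat}.
Implicit Types (P : 'I_n -> set 'rV[R]_n) (I : {set 'I_n}).

Definition conv_hull (V : seq 'rV[R]_n) : set 'rV[R]_n :=
  [set x | exists c : 'I_(size V) -> R,
      [/\ forall i, 0 <= c i, \sum_i c i = 1 & x = \sum_i c i *: V`_i]]%classic.

(* The empty set is allowed, being the Newton polytope of 0. *)
Definition integral_polytope (A : set 'rV[R]_n) : Prop :=
  exists V : seq 'rV[int]_n, A = conv_hull [seq map_mx intr v | v <- V].

Definition nonneg_orthant : set 'rV[R]_n :=
  [set x | forall i, 0 <= x 0 i]%classic.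

(* R^I, and below A^I = A \cap R^I *)
Definition real_subspace I : set 'rV[R]_n :=
  [set x | forall i, i \notin I -> x 0 i = 0]%classic.

Definition face_on (A : set 'rV[R]_n) I : set 'rV[R]_n :=
  (A `&` real_subspace I)%classic.

Definition NPI P I : {set 'I_n} :=
  [set j | `[< (face_on (P j) I !=set0)%classic >]].

Definition in_E P I : Prop :=
  exists J : {set 'I_n}, I \subset J /\ (#|NPI P J| < #|J|)%N.

End Polytopes.

Section Polynomials.
Context {K : closedFieldType} {n : nat}.
Implicit Types (I S : {set 'I_n}) (p : {mpoly K[n]}) (w : 'I_n -> int).

(* K^I and (K^* )^I *)
Definition coord_subspace I (x : 'I_n -> K) : Prop :=
  forall i, i \notin I -> x i = 0.

Definition torus I (x : 'I_n -> K) : Prop :=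
  coord_subspace I x /\ (forall i, i \in I -> x i != 0).

Definition common_zero m (g : 'I_m -> {mpoly K[n]}) (x : 'I_n -> K) : Prop :=
  forall j, (g j).@[x] = 0.

(* K[x_i : i \in I] is regarded as a subring of K[x_1, ..., x_n]. *)
Definition restr I p : {mpoly K[n]} :=
  comp_mpoly [tuple (if i \in I then 'X_i else 0) | i < n] p.

(* Weights (w_i)_(i \in I) are given by functions on 'I_n, the values of which
   outside I are never used. *)
Definition weight_of I w (m : 'X_{1..n}) : int := \sum_(i in I) w i *+ m i.

Definition weights_gcd I w : nat := \big[gcdn/0%N]_(i in I) `|w i|%N.

Definition weighted_degree_at_infinity I w : Prop :=
  weights_gcd I w = 1%N /\ (exists2 i, i \in I & 0 < w i).

Definition monomial_valuation I w : Prop :=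
  (forall i, i \in I -> w i = 0) \/ weights_gcd I w = 1%N.

Definition Ld I w p : {mpoly K[n]} :=
  \sum_(m <- msupp p |
        all (fun m' => weight_of I w m' <= weight_of I w m) (msupp p))
     p@_m *: 'X_[m].

Definition In I w p : {mpoly K[n]} :=
  \sum_(m <- msupp p |
        all (fun m' => weight_of I w m <= weight_of I w m') (msupp p))
     p@_m *: 'X_[m].

Definition BKK_nondeg_infinity I m (g : 'I_m -> {mpoly K[n]}) : Prop :=
  forall w, weighted_degree_at_infinity I w ->
    ~ exists2 x, torus [set: 'I_n] x & common_zero (fun j => Ld I w (g j)) x.

Definition centered_at I (C : {set {set 'I_n}}) w : Prop :=
  exists2 S, S \in C &
    (forall s, s \in S -> w s = 0) /\ (forall s, s \in I :\: S -> 0 < w s).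

Definition BKK_nondeg_at I (C : {set {set 'I_n}}) m
    (g : 'I_m -> {mpoly K[n]}) : Prop :=
  forall w, monomial_valuation I w -> centered_at I C w ->
    ~ exists2 x, torus [set: 'I_n] x & common_zero (fun j => In I w (g j)) x.

End Polynomials.

Section Admissible.
Context {R : realType} {K : closedFieldType} {n : nat}.
Implicit Types (P : 'I_n -> set 'rV[R]_n) (f g : 'I_n -> {mpoly K[n]}).
Implicit Types (I J : {set 'I_n}).

Definition newton_polytope (p : {mpoly K[n]}) : set 'rV[R]_n :=
  conv_hull [seq (\row_i (m i)%:R) | m : 'X_{1..n} <- msupp p].

Definition admissible P f : Prop := forall j, newton_polytope (f j) = P j.

(* The coefficients of g_1, ..., g_n in degrees < d, as a point of affine
   space over K. *)
Definition coef_vec d g (k : 'I_#|{: 'I_n * 'X_{1..n < d}}|) : K :=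
  (g (enum_val k).1)@_((enum_val k).2).

(* Q holds on a nonempty Zariski open subset of the set of P-admissible
   systems: the open set is the complement of the zero locus of a finite family
   of polynomials in the coefficients of g. All P-admissible systems have a
   common degree bound, and a smaller d only means that the equations of the
   closed set do not involve the remaining coefficients. *)
Definition generic_admissible P (Q : ('I_n -> {mpoly K[n]}) -> Prop) : Prop :=
  exists d (F : seq {mpoly K[#|{: 'I_n * 'X_{1..n < d}}|]}),
    let U g := exists2 h, h \in F & h.@[coef_vec g] != 0 in
    (exists2 g, admissible P g & U g) /\
    (forall g, admissible P g -> U g -> Q g).

End Admissible.

Section Triviality.
Context {R : realType} (K : closedFieldType) {n : nat}.
Implicit Types (P : 'I_n -> set 'rV[R]_n) (I J : {set 'I_n}).
Implicit Types (SS : {set {set 'I_n}}).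

Definition torus_trivial P I : Prop :=
  generic_admissible P (fun g : 'I_n -> {mpoly K[n]} =>
    ~ exists2 x, torus I x & common_zero g x).

Definition exotrivial P I : Prop :=
  in_E P I \/
  (torus_trivial P I /\
   exists J, [/\ I \subset J, torus_trivial P J, #|NPI P J| = #|J| &
     forall I' : {set 'I_n}, I \subset I' -> I' \proper J ->
       (#|I'| < #|NPI P I'|)%N]).

Definition down_closure SS : {set {set 'I_n}} :=
  [set J : {set 'I_n} | [exists S in SS, J \subset S]].

Definition subsets_in SS I : {set {set 'I_n}} := [set S in SS | S \subset I].

Definition TT P SS : {set {set 'I_n}} :=
  [set I | (I \notin down_closure SS) && `[< exotrivial P I >]].

Definition TT' P SS : {set {set 'I_n}} :=
  [set I | (I \notin down_closure SS) && ~~ `[< exotrivial P I >]].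

Definition TTstar P SS : {set {set 'I_n}} :=
  [set I in TT P SS | #|NPI P I| == #|I|].

Definition NSP P SS : {set {set 'I_n}} :=
  [set I in TT' P SS | ~~ `[< torus_trivial P I >]].

End Triviality.

Section NonDegeneracy.
Context {R : realType} {K : closedFieldType} {n : nat}.
Implicit Types (P : 'I_n -> set 'rV[R]_n) (SS : {set {set 'I_n}}).
Implicit Types (f : 'I_n -> {mpoly K[n]}).

(* P-non-degeneracy on the complement in K^n of the union of the tori
   (K^* )^S, S in down_closure SS *)
Definition nondegenerate_on P SS f : Prop :=
  [/\ admissible P f,
      forall I, I \in TT' K P SS ->
        BKK_nondeg_infinity I (fun j => restr I (f j)) /\
        BKK_nondeg_at I (subsets_in (down_closure SS :|: TT K P SS) I)
          (fun j => restr I (f j))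
    & forall I, I \in TT K P SS ->
        BKK_nondeg_at I (subsets_in (TT' K P SS) I)
          (fun j => restr I (f j))].

End NonDegeneracy.

(* Main.v *)
Require Import Defs.
From HB Require Import structures.
From mathcomp Require Import all_boot all_order all_algebra.
From mathcomp Require Import boolp classical_sets reals.
From mathcomp Require Import mpoly.
From mathcomp Require Import ring_quotient fraction ring lra zify.

Set Implicit Arguments.
Unset Strict Implicit.
Unset Printing Implicit Defensive.

Import Order.TTheory GRing.Theory Num.Theory.
Local Open Scope ring_scope.

(** Under admissibility, N^I is the set of the j with f_j|K^I <> 0
    ([NPI_nonvanishing]), and triviality enters only through the combinatorics
    of the definitions.  Condition (1) contains condition (2).  For the converse,
    two kinds of I remain.

    - I is in T' and trivial.  Take J containing I, minimal with |N^J| <= |J|; the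
      set [n] is a candidate.  As I is not in E, |N^J| = |J|, and J is not trivial
      because I is not exotrivial.  Hence J is in N_(S,P), and (ii) applies to J.
    - I is in T and |N^I| <> |I|.  If some S in T' lies in I, then I is not in E,
      and the J that witnesses exotriviality is in T^*, so that (iii) applies.

    In both cases |N^I'| > |I'| for all I' with I <= I' < J, and degeneracy of f
    on K^I must be carried to K^J: a common zero a in the torus of the initial
    forms for weights w on I has to produce one for weights on J which have the
    signs of w on I and are positive on J \ I ([degeneracy_extends]).  It is
    enough to enlarge I by at least one element and to iterate
    ([extension_step]).  Over K(t), substitute x_i = a_i t^(w_i) for i in I, and
    keep y_i = x_i as an unknown for i in J \ I.  The f_j with j in N^J \ N^I
    become polynomials in y without constant term, and there are fewer of them,
    |N^J| - |N^I| < |J| - |I|, than unknowns.  So the origin is not an isolated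
    zero, and there is a field F over K(t) with a nonzero solution y in F, whose
    coordinates specialize to 0 at the origin ([branch_through_origin]).  Add to
    I the i with y_i <> 0.  A valuation of F that is centred at t = 0 and y = 0
    with residue field K gives the new weights as orders and the new zero as
    leading coefficients: the f_j with j in N^I have leading forms with value
    In_w(f_j)(a) = 0, the others vanish in F.

    Three tools make this elementary.  That fewer than n equations do not isolate
    the origin follows from counting dimensions of K[y]/(y)^E
    ([few_equations_not_isolated]).  A valuation is needed only on the finitely
    many Laurent monomials that occur, so it is replaced by a partially defined
    K-algebra morphism from F to K, enlarged as in Chevalley's extension theorem
    ([not_both_relations], [place_decide]).  Integral weights come from
    Fourier-Motzkin elimination ([separating_weight]), and leading coefficients
    from the divisibility of K^* ([character_extend]); see [place_weights] and
    [place_initial_zero]. *)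

(** * Prime ideals and morphisms to fields *)

(** Inverses are chosen classically, which makes the domain a unit ring; its
    field of fractions then does the job. *)
Lemma integral_ring_embeds_in_field (Q : comNzRingType) :
  (forall x y : Q, x * y = 0 -> (x == 0) || (y == 0)) ->
  exists (F : fieldType) (phi : {rmorphism Q -> F}), injective phi.
Proof.
move=> domQ.
pose isU (x : Q) := `[< exists y, y * x = 1 >].
pose inv (x : Q) := if pselect (exists y, y * x = 1) is left ex then projT1 (cid ex)
                    else x.
have mulVx : {in isU, left_inverse 1 inv *%R}.
  move=> x /asboolP ex; rewrite /inv; case: pselect => // ex'.
  by case: cid => y.
have unitPl x y : y * x = 1 -> x \in isU.
  by move=> yx1; apply/asboolP; exists y.
have invx : {in [predC isU], inv =1 id}.
  move=> x /asboolP nex; rewrite /inv; by case: pselect.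
pose Um := GRing.ComNzRing_hasMulInverse.Build Q mulVx unitPl invx.
pose Q' : comUnitRingType := HB.pack (GRing.ComNzRing.sort Q) Um.
pose Im := GRing.ComUnitRing_isIntegral.Build Q' domQ.
pose Q'' : idomainType := HB.pack (GRing.ComUnitRing.sort Q') Im.
exists {fraction Q''}.
exists ((@FracField.tofrac Q'' : {rmorphism Q'' -> {fraction Q''}})
         : {rmorphism Q -> {fraction Q''}}).
move=> x y /eqP; have /= -> := @tofrac_eq Q'' x y.
by move=> /eqP.
Qed.

Definition ideal_pred (R : comNzRingType) (p : R -> Prop) : Prop :=
  p 0 /\ forall a x y, p x -> p y -> p (a * x + y).

Section PrimeQuotient.
Variables (R : comNzRingType) (p : R -> Prop).
Hypotheses (pI : ideal_pred p) (p1 : ~ p 1).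
Hypothesis pM : forall x y, p (x * y) -> p x \/ p y.

Let S : pred R := fun x => `[< p x >].

Fact idealS : idealr_closed S.
Proof.
split; [by apply/asboolP; case: pI | by apply/asboolP |].
by move=> a x y /asboolP px /asboolP py; apply/asboolP; apply: pI.2.
Qed.

Fact primeS : prime_idealr_closed S.
Proof.
move=> x y /asboolP /pM [px|py]; first by apply/orP; left; apply/asboolP.
by apply/orP; right; apply/asboolP.
Qed.

HB.instance Definition _ := isIdealr.Build R S idealS.
HB.instance Definition _ := isPrimeIdealrClosed.Build R S primeS.

Lemma prime_is_kernel_to_field :
  exists (F : fieldType) (phi : {rmorphism R -> F}), forall x, phi x = 0 <-> p x.
Proof.
pose Q : comNzRingType := {ideal_quot (S : prime_idealr R)}.
have [F [phi phiI]] : exists (F : fieldType) (phi : {rmorphism Q -> F}), injective phi.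
  apply: integral_ring_embeds_in_field => x y.
  exact: Quotient.rquot_IdomainAxiom.
pose pi : {rmorphism R -> Q} := \pi_({ideal_quot (S : prime_idealr R)})%qT.
exists F, (phi \o pi : {rmorphism R -> F}) => x /=.
have -> : p x <-> pi x = 0.
  have <- : S x <-> p x by split => /asboolP.
  rewrite -(rmorph0 pi); have := Quotient.idealrBE (S : prime_idealr R) x 0.
  by rewrite subr0 -[x \in _]/(S x) => ->; split => /eqP.
by split => [|->]; [rewrite -(rmorph0 phi) => /phiI | rewrite rmorph0].
Qed.
End PrimeQuotient.
(** An ideal that is maximal among those containing I and disjoint from the
    multiplicative set S is prime. *)
Lemma prime_avoiding (R : comNzRingType) (I S : R -> Prop) :
    ideal_pred I -> S 1 -> (forall x y, S x -> S y -> S (x * y)) ->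
    (forall x, I x -> ~ S x) ->
  exists p : R -> Prop, [/\ ideal_pred p, forall x, I x -> p x,
    forall x, p x -> ~ S x & forall x y, p (x * y) -> p x \/ p y].
Proof.
move=> [I0 Iadd] S1 SM disj.
(* The empty set is admitted because the chain in Zorn's lemma may be empty. *)
pose good (X : set R) := [/\ forall a x y, X x -> X y -> X (a * x + y),
  forall x, X x -> ~ S x & (exists x, X x) -> forall x, I x -> X x].
have [X [[Xadd XS XI] Xmax]] : exists A, good A /\ forall B, (A `<` B)%classic -> ~ good B.
  apply: Zorn_bigcup => F Fgood Ftot; split.
  - move=> a x y [A FA Ax] [B FB By].
    have [AB|BA] := Ftot A B FA FB.
      by exists B => //; case: (Fgood B FB) => h _ _; apply: h => //; apply: AB.
    by exists A => //; case: (Fgood A FA) => h _ _; apply: h => //; apply: BA.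
  - by move=> x [A FA Ax]; case: (Fgood A FA) => _ h _; apply: h.
  - move=> [x [A FA Ax]] y Iy; exists A => //.
    by case: (Fgood A FA) => _ _ h; apply: h => //; exists x.
have goodI : good I by split.
have Xne : exists x, X x.
  apply: contrapT => nX; apply: (Xmax I) => //; split.
    by move=> x Xx; case: nX; exists x.
  by move=> IX; apply: nX; exists 0; apply: IX.
have X0 : X 0 by exact: XI.
have XM a x : X x -> X (a * x) by move=> Xx; rewrite -[_ * _]addr0; apply: Xadd.
exists X; split=> //; first exact: XI.
(* Adjoining a non-member u to X produces an element of S by maximality. *)
have adj u : ~ X u -> exists a x, X x /\ S (a * u + x).
  move=> nXu; apply: contrapT => nS.
  pose Y : set R := [set y | exists a x, X x /\ y = a * u + x]%classic.
  apply: (Xmax Y).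
    split=> [x Xx|YX]; first by exists 0, x; rewrite mul0r add0r.
    by apply: nXu; apply: YX; exists 1, 0; rewrite mul1r addr0.
  split.
  - move=> a _ _ [b [x [Xx ->]]] [c [y [Xy ->]]].
    exists (a * b + c), (a * x + y); split; first exact: Xadd.
    by rewrite mulrDr mulrDl !mulrA addrACA.
  - by move=> _ [a [x [Xx ->]]] Sx; apply: nS; exists a, x.
  - by move=> _ x Ix; exists 0, x; rewrite mul0r add0r; split=> //; apply: XI.
move=> u v Xuv; have [Xu|/adj [a [x [Xx Sx]]]] := EM (X u); first by left.
have [Xv|/adj [b [y [Xy Sy]]]] := EM (X v); first by right.
case: (XS _ _ (SM _ _ Sx Sy)).
rewrite mulrDl [a * u * _]mulrDr.
have -> : a * u * (b * v) = (a * b) * (u * v) by rewrite mulrACA.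
rewrite -addrA; apply: (Xadd) => //; rewrite [x * _]mulrC.
by apply: Xadd => //; apply: XM.
Qed.

(** * Polynomials modulo high powers of the maximal ideal of the origin *)

Section TruncatedLinearAlgebra.
Variables (L : fieldType) (n : nat).
Implicit Types p q : {mpoly L[n]}.

Definition order_ge E p : Prop := forall m, (mdeg m < E)%N -> p@_m = 0.

Lemma order_geD E p q : order_ge E p -> order_ge E q -> order_ge E (p + q).
Proof. by move=> hp hq m lt; rewrite mcoeffD hp ?hq ?addr0. Qed.

Lemma order_geM a b p q :
  order_ge a p -> order_ge b q -> order_ge (a + b) (p * q).
Proof.
move=> hp hq m lt; rewrite mcoeffM big1 // => -[k1 k2] /= /eqP def_m.
have [lt1|ge1] := ltnP (mdeg k1) a; first by rewrite hp ?mul0r.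
rewrite [q@__]hq ?mulr0 //.
have {}def_m : mdeg m = (mdeg k1 + mdeg k2)%N by rewrite -mdegD -def_m.
have le : (a + mdeg k2 <= mdeg m)%N by apply: leq_trans (eq_leq (esym def_m)); rewrite leq_add2r.
by rewrite -(ltn_add2l a); apply: leq_ltn_trans lt.
Qed.

Lemma order_ge_weak a b p : (a <= b)%N -> order_ge b p -> order_ge a p.
Proof. by move=> le hp m lt; apply: hp; apply: leq_trans le. Qed.

Lemma order_ge1 p : p@_0%MM = 0 -> order_ge 1 p.
Proof. by move=> p0 m; rewrite ltnS leqn0 mdeg_eq0 => /eqP ->. Qed.

Lemma order_geX k a p : order_ge a p -> order_ge (a * k) (p ^+ k).
Proof.
move=> hp; elim: k => [|k IH]; first by rewrite muln0.
by rewrite exprS mulnS; apply: order_geM.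
Qed.

Lemma order_geMr a p q : order_ge a p -> order_ge a (q * p).
Proof. by move=> hp; rewrite -[a]add0n; apply: order_geM. Qed.

Lemma order_ge_zero E : order_ge E 0.
Proof. by move=> m _; rewrite mcoeff0. Qed.

Lemma order_ge_prod (I : finType) (g : I -> {mpoly L[n]}) (b : I -> nat) :
  (forall i, (g i)@_0%MM = 0) -> order_ge (\sum_i b i) (\prod_i g i ^+ b i).
Proof.
move=> g0; elim/big_rec2: _ => // i y x _ hx.
apply: order_geM => //; have := order_geX (k := b i) (order_ge1 (g0 i)).
by rewrite mul1n.
Qed.

Definition spans E (T : finType) (v : T -> {mpoly L[n]}) p : Prop :=
  exists b : T -> L, order_ge E (p - \sum_t b t *: v t).

Variables (E : nat) (T : finType) (v : T -> {mpoly L[n]}).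

Lemma spans_order p : order_ge E p -> spans E v p.
Proof. by exists (fun=> 0); rewrite big1 ?subr0 // => t _; rewrite scale0r. Qed.

Lemma spans_mem t : spans E v (v t).
Proof.
exists (fun u => (u == t)%:R); rewrite (bigD1 t) //= eqxx scale1r big1 => [|u /negPf->].
  by rewrite addr0 subrr; apply: order_ge_zero.
by rewrite scale0r.
Qed.

Lemma spansD p q : spans E v p -> spans E v q -> spans E v (p + q).
Proof.
move=> [b hb] [c hc]; exists (fun t => b t + c t).
under eq_bigr do rewrite scalerDl.
by rewrite big_split /= opprD addrACA; apply: order_geD.
Qed.

Lemma spansZ a p : spans E v p -> spans E v (a *: p).
Proof.
move=> [b hb]; exists (fun t => a * b t).
under eq_bigr do rewrite -scalerA.
rewrite -scaler_sumr -scalerBr => m lt.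
by rewrite mcoeffZ hb ?mulr0.
Qed.

Lemma spans_sum (I : Type) (s : seq I) (P : pred I) (F : I -> {mpoly L[n]}) :
  (forall i, P i -> spans E v (F i)) -> spans E v (\sum_(i <- s | P i) F i).
Proof.
move=> hF; elim/big_rec: _ => [|i x Pi hx]; first exact/spans_order/order_ge_zero.
by apply: spansD => //; apply: hF.
Qed.

Definition box_mnm N (a : {ffun 'I_n -> 'I_N}) : 'X_{1..n} :=
  [multinom val (a i) | i < n].

Lemma box_mnm_inj N : injective (@box_mnm N).
Proof.
by move=> a b /mnmP ab; apply/ffunP => i; apply/val_inj; have := ab i; rewrite !mnmE.
Qed.

(** The box monomials are linearly independent modulo (X)^E, having degree at most
    n (e - 1) < E; so a family that spans them has at least e^n elements. *)
Lemma spans_box_card e : (0 < e)%N -> (n * e <= E)%N -> (0 < n)%N ->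
  (forall a : {ffun 'I_n -> 'I_e}, spans E v 'X_[box_mnm a]) -> (e ^ n <= #|T|)%N.
Proof.
move=> e0 leE n0 /choice[b hb].
pose B := {ffun 'I_n -> 'I_e}.
have -> : (e ^ n)%N = #|{: B}| by rewrite card_ffun !card_ord.
pose M : 'M[L]_(#|{: B}|, #|T|) := \matrix_(i, j) b (enum_val i) (enum_val j).
pose V : 'M[L]_(#|T|, #|{: B}|) :=
  \matrix_(i, j) (v (enum_val i))@_(box_mnm (enum_val j : B)).
suff MV : M *m V = 1%:M.
  have := mxrankM_maxr M V; rewrite MV mxrank1 => /leq_trans; apply.
  exact: rank_leq_row.
apply/matrixP => i j; rewrite !mxE.
have lt : (mdeg (box_mnm (enum_val j : B)) < E)%N.
  apply: leq_trans leE; rewrite mdegE.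
  apply: (@leq_ltn_trans (\sum_(i < n) e.-1)%N).
    by apply: leq_sum => k _; rewrite mnmE -ltnS prednK ?ltn_ord.
  by rewrite sum_nat_const card_ord ltn_pmul2l // prednK.
have := hb (enum_val i) _ lt; rewrite mcoeffB mcoeffX => /eqP.
rewrite subr_eq0 => /eqP/esym e1.
rewrite (inj_eq (@box_mnm_inj e)) (inj_eq enum_val_inj) in e1.
rewrite -e1 raddf_sum [RHS](reindex (@enum_val T T)) /=; last first.
  exact/onW_bij/enum_val_bij.
by apply: eq_bigr => k _; rewrite !mxE mcoeffZ.
Qed.

End TruncatedLinearAlgebra.

(** * Fewer equations than unknowns do not isolate the origin *)

Section FewEquations.
Variables (L : fieldType) (n r : nat) (g : 'I_r -> {mpoly L[n]}).
Hypothesis g0 : forall j, (g j)@_0%MM = 0.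

Local Notation gpow := (fun b : 'I_r -> nat => \prod_j g j ^+ b j).

Definition in_ideal_mod E (p : {mpoly L[n]}) : Prop :=
  exists c, order_ge E (p - \sum_j c j * g j).

Lemma in_ideal_modM E a p : in_ideal_mod E p -> in_ideal_mod E (a * p).
Proof.
move=> [c hc]; exists (fun j => a * c j); under eq_bigr do rewrite -mulrA.
by rewrite -mulr_sumr -mulrBr; apply: order_geMr.
Qed.

Lemma in_ideal_mod_order E p q :
  order_ge E q -> in_ideal_mod E p -> in_ideal_mod E (p + q).
Proof. by move=> hq [c hc]; exists c; rewrite addrAC; apply: order_geD. Qed.

(** A polynomial h with h(0) <> 0 is invertible modulo (X)^E, by the geometric
    series in q = 1 - h / h(0). *)
Lemma in_ideal_mod_unit E h p : h@_0%MM != 0 -> (exists c, h * p = \sum_j c j * g j) ->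
  in_ideal_mod E p.
Proof.
move=> h0 [c hp]; pose q := 1 - (h@_0%MM)^-1 *: h.
have q0 : order_ge 1 q.
  by apply: order_ge1; rewrite mcoeffB mcoeffZ mcoeff1 eqxx mulVf ?subrr.
have geo : (\sum_(i < E) q ^+ i) * ((h@_0%MM)^-1 *: h) = 1 - q ^+ E.
  have -> : (h@_0%MM)^-1 *: h = 1 - q by rewrite /q opprB addrCA subrr addr0.
  rewrite mulrC; have := @subrX1 _ q E.
  by move=> e; rewrite -[1 - q]opprB mulNr -e opprB.
have -> : p = (\sum_(i < E) q ^+ i) * (h@_0%MM)^-1%:MP * (h * p) + p * q ^+ E.
  rewrite mulrA -[_ * h]mulrA mul_mpolyC geo mulrBl mul1r.
  by rewrite [q ^+ E * p]mulrC subrK.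
apply: in_ideal_mod_order; first by apply: order_geMr; have := order_geX (k := E) q0; rewrite mul1n.
apply: in_ideal_modM; exists c; rewrite hp subrr; exact: order_ge_zero.
Qed.

Section Isolated.
Variables (N E : nat).
Hypothesis XN : forall i, in_ideal_mod E ('X_i ^+ N).

(** A monomial outside the box is divisible by some X_i^N, which lies in the ideal
    modulo (X)^E. *)
Lemma box_division p : exists (b : {ffun 'I_n -> 'I_N} -> L) (c : 'I_r -> {mpoly L[n]}),
  order_ge E (p - \sum_a b a *: 'X_[box_mnm a] - \sum_j c j * g j).
Proof.
suff [q [hq [c hc]]] : exists q,
    spans E (fun a : {ffun 'I_n -> 'I_N} => 'X_[box_mnm a]) q /\ in_ideal_mod E (p - q).
  have [b hb] := hq; exists b, c.
  set B := \sum_a _ in hb *; set C := \sum_j _ in hc *.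
  have -> : p - B - C = (p - q - C) + (q - B) by ring.
  exact: order_geD.
rewrite [p]mpolyE; elim: (msupp p) => [|m s [q [hq [c hc]]]].
  exists 0; rewrite big_nil subr0; split; first exact/spans_order/order_ge_zero.
  by exists (fun=> 0); rewrite big1 => [|j _]; rewrite ?mul0r // subr0; apply: order_ge_zero.
rewrite big_cons; set P := \sum_(_ <- s) _ in hc *.
have [/forallP mN|/forallPn /= [i]] := boolP [forall i, m i < N]%N.
  exists (p@_m *: 'X_[m] + q); split.
    apply: spansD => //; apply: spansZ.
    have -> : m = box_mnm [ffun i => Ordinal (mN i)].
      by apply/mnmP => i; rewrite mnmE ffunE.
    exact: (spans_mem E (fun a : {ffun 'I_n -> 'I_N} => 'X_[box_mnm a])).
  by exists c; rewrite opprD addrACA subrr add0r.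
rewrite -leqNgt => Nm; exists q; split => //.
have [d hd] : in_ideal_mod E (p@_m *: 'X_[m]).
  have -> : p@_m *: 'X_[m] = p@_m *: 'X_[m - U_(i) *+ N] * 'X_i ^+ N.
    rewrite mpolyXn -scalerAl -mpolyXD submK //; apply/mnm_lepP => j.
    by rewrite mulmnE mnm1E; case: eqP => [<-|]; rewrite ?mul1n.
  exact: in_ideal_modM.
exists (fun j => d j + c j); under eq_bigr do rewrite mulrDl.
rewrite big_split /=; set D := \sum_j _ in hd *; set C := \sum_j _ in hc *.
set M := p@_m *: _ in hd *.
have -> : M + P - q - (D + C) = (M - D) + (P - q - C) by ring.
exact: order_geD.
Qed.

(** Box division applied repeatedly to the cofactors of the g_j: the products of
    E of the g_j, which have order at least E, can be dropped. *)
Lemma spans_box_gpow p :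
  spans E (fun ab : {ffun 'I_n -> 'I_N} * {ffun 'I_r -> 'I_E} =>
             'X_[box_mnm ab.1] * gpow (fun j => val (ab.2 j))) p.
Proof.
set v := (X in spans _ X).
suff main s (b : 'I_r -> nat) : (E <= \sum_j b j + s)%N -> forall q, spans E v (gpow b * q).
  have := main E (fun=> 0%N) (leq_addl _ _) p.
  by rewrite big1 ?mul1r.
elim: s b => [|s IH] b leE q; rewrite ?addn0 in leE.
  apply: spans_order; rewrite mulrC; apply: order_geMr.
  by apply: order_ge_weak leE _; apply: order_ge_prod.
have [geE|ltE] := leqP E (\sum_j b j).
  apply: spans_order; rewrite mulrC; apply: order_geMr.
  by apply: order_ge_weak geE _; apply: order_ge_prod.
have [e [c hc]] := box_division q.
set A := \sum_a _ in hc; set C := \sum_j _ in hc.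
have -> : q = (q - A - C) + A + C by ring.
rewrite mulrDr mulrDr; apply: spansD; first apply: spansD.
- by apply: spans_order; apply: order_geMr.
- rewrite mulr_sumr; apply: spans_sum => a _; rewrite -scalerAr; apply: spansZ.
  have bE j : (b j < E)%N by apply: leq_ltn_trans ltE; rewrite (bigD1 j) //= leq_addr.
  have -> : gpow b * 'X_[box_mnm a] = v (a, [ffun j => Ordinal (bE j)]).
    by rewrite mulrC /v /=; congr (_ * _); apply: eq_bigr => j _; rewrite ffunE.
  exact: spans_mem.
- rewrite mulr_sumr; apply: spans_sum => j _.
  have -> : gpow b * (c j * g j) = gpow (fun k => b k + (k == j))%N * c j.
    rewrite mulrC -mulrA mulrC; congr (_ * _).
    rewrite (bigD1 j) //= [RHS](bigD1 j) //= eqxx addn1 exprS mulrA; congr (_ * _).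
    by apply: eq_bigr => k /negPf ->; rewrite addn0.
  apply: IH; rewrite big_split /= -addnA; apply: leq_trans leE _.
  rewrite leq_add2l (bigD1 j) //= eqxx big1 => [|k /negPf -> //].
  by rewrite addn0 add1n.
Qed.

End Isolated.

(** If h_i X_i^(k_i) lay in the ideal for every i, with h_i(0) <> 0, then the e^n box
    monomials would be spanned modulo (X)^(ne) by N^n (ne)^r elements, with N
    independent of e; this is false for large e since r < n. *)
Lemma few_equations_not_isolated : (r < n)%N ->
  exists i, forall h k c, h@_0%MM != 0 -> h * 'X_i ^+ k <> \sum_j c j * g j.
Proof.
move=> ltrn; apply: contrapT => nex.
have /choice[k hk] : forall i, exists k : nat, forall E, in_ideal_mod E ('X_i ^+ k).
  move=> i; apply: contrapT => nk; apply: nex; exists i => h k c h0 e.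
  by apply: nk; exists k => E; apply: in_ideal_mod_unit h0 _; exists c.
pose N := (\sum_i k i)%N.
have XN E i : in_ideal_mod E ('X_i ^+ N).
  by rewrite /N (bigD1 i) //= addnC exprD; apply: in_ideal_modM.
have n0 : (0 < n)%N by apply: leq_ltn_trans ltrn.
(* Any e beyond N^n n^n contradicts e^n <= N^n (n e)^r. *)
pose e := (N ^ n * n ^ n).+1.
have := @spans_box_card L n (n * e) _ _ e isT (leqnn _) n0
  (fun a => spans_box_gpow (XN (n * e)%N) 'X_[box_mnm a]).
rewrite card_prod !card_ffun !card_ord => le1.
have le2 : ((n * e) ^ r <= n ^ n * e ^ n.-1)%N.
  rewrite expnMn leq_mul // leq_pexp2l //; first exact: ltnW.
  by rewrite -ltnS prednK.
have := leq_trans le1 (leq_mul (leqnn _) le2).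
rewrite -{1}(prednK n0) expnS mulnA leq_pmul2r ?expn_gt0 //.
by rewrite ltnn.
Qed.

End FewEquations.

(** The point of Spec given by a prime ideal that contains the g_j, lies in the ideal
    of the origin, and misses some X_i: such a prime exists as soon as the ideal of the
    g_j avoids the products h X_i^k with h(0) <> 0. *)
Lemma branch_through_origin (L : fieldType) (n r : nat) (g : 'I_r -> {mpoly L[n]}) :
    (forall j, (g j)@_0%MM = 0) -> (r < n)%N ->
  exists (F : fieldType) (phi : {rmorphism {mpoly L[n]} -> F}),
    [/\ forall j, phi (g j) = 0, forall q, phi q = 0 -> q@_0%MM = 0 &
        exists i, phi 'X_i != 0].
Proof.
move=> g0 ltrn; have [i hi] := few_equations_not_isolated g0 ltrn.
pose I (p : {mpoly L[n]}) := exists c, p = \sum_j c j * g j.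
pose S (p : {mpoly L[n]}) := exists h k, h@_0%MM != 0 /\ p = h * 'X_i ^+ k.
have [p [idp Ip pS pM]] : exists p : {mpoly L[n]} -> Prop,
    [/\ ideal_pred p, forall x, I x -> p x, forall x, p x -> ~ S x
      & forall x y, p (x * y) -> p x \/ p y].
  apply: prime_avoiding.
  - split; first by exists (fun=> 0); rewrite big1 // => j _; rewrite mul0r.
    move=> a x y [c ->] [d ->]; exists (fun j => a * c j + d j).
    rewrite mulr_sumr -big_split /=; apply: eq_bigr => j _.
    by rewrite mulrDl mulrA.
  - by exists 1, 0%N; rewrite mcoeff1 eqxx oner_neq0 expr0 mulr1.
  - move=> x y [h [k [h0 ->]]] [h' [k' [h0' ->]]]; exists (h * h'), (k + k')%N.
    by rewrite rmorphM mulf_neq0 // exprD mulrACA.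
  - by move=> x [c ->] [h [k [h0 e]]]; apply: (hi h k c h0).
have p1 : ~ p 1.
  by move=> /pS[]; exists 1, 0%N; rewrite mcoeff1 eqxx oner_neq0 expr0 mulr1.
have [F [phi phiP]] := prime_is_kernel_to_field idp p1 pM.
exists F, phi; split.
- move=> j; apply/phiP/Ip; exists (fun k => (k == j)%:R).
  rewrite (bigD1 j) //= eqxx mul1r big1 ?addr0 // => k /negPf ->.
  by rewrite mul0r.
- move=> q /phiP pq; apply/eqP; apply: contrapT => /negP q0.
  by apply: (pS q pq); exists q, 0%N; rewrite expr0 mulr1.
- exists i; apply/eqP => /phiP pX; apply: (pS _ pX); exists 1, 1%N.
  by rewrite mcoeff1 eqxx oner_neq0 mul1r expr1.
Qed.

(** * Places: partial morphisms from a field to K *)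

Section Places.
Variables (K : closedFieldType) (F : fieldType) (iota : {rmorphism K -> F}).
Implicit Types (Phi : F -> K -> Prop).

(** The graph of a K-algebra morphism to K from a subalgebra of F: [place01] is
    equivalent to the graph being functional ([place_fun]). *)
Record partial_place Phi : Prop := PartialPlace {
  placeC : forall c, Phi (iota c) c;
  placeD : forall x y c d, Phi x c -> Phi y d -> Phi (x + y) (c + d);
  placeM : forall x y c d, Phi x c -> Phi y d -> Phi (x * y) (c * d);
  place01 : ~ Phi 0 1 }.

Section Basics.
Variables (Phi : F -> K -> Prop) (PhiP : partial_place Phi).

Lemma place0 : Phi 0 0. Proof. by rewrite -(rmorph0 iota); apply: placeC. Qed.
Lemma place1 : Phi 1 1. Proof. by rewrite -(rmorph1 iota); apply: placeC. Qed.

Lemma placeN x c : Phi x c -> Phi (- x) (- c).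
Proof.
move=> h; rewrite -mulN1r -[- c]mulN1r -(rmorphN1 iota).
by apply: placeM => //; apply: placeC.
Qed.

Lemma place_fun x c d : Phi x c -> Phi x d -> c = d.
Proof.
move=> hc hd; apply/eqP; rewrite -subr_eq0; apply: contrapT => /negP ncd.
apply: (place01 PhiP); rewrite -(mulVf ncd) -(mulr0 (iota (c - d)^-1)) -(subrr x).
by apply: placeM => //; [apply: placeC | apply: placeD => //; apply: placeN].
Qed.

Lemma place_sum (I : Type) (s : seq I) (P : pred I) (f : I -> F) (c : I -> K) :
  (forall i, P i -> Phi (f i) (c i)) ->
  Phi (\sum_(i <- s | P i) f i) (\sum_(i <- s | P i) c i).
Proof.
move=> h; elim/big_rec2: _ => [|i y x Pi hx]; first exact: place0.
by apply: placeD => //; apply: h.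
Qed.

(** The graph generated by Phi and the pair (z, c). *)
Definition adjoin z c x d : Prop := exists (p : {poly F}) (q : {poly K}),
  [/\ forall i, Phi p`_i q`_i, x = p.[z] & d = q.[c]].

(** The reductions q of the polynomials that vanish at z: the value of z must be a
    common root of these. *)
Definition relation_poly z (q : {poly K}) : Prop :=
  exists p : {poly F}, (forall i, Phi p`_i q`_i) /\ p.[z] = 0.

Lemma place_polyC x c i : Phi x c -> Phi (x%:P)`_i (c%:P)`_i.
Proof. by move=> h; rewrite !coefC; case: eqP => // _; apply: place0. Qed.

Lemma place_polyM (p p' : {poly F}) (q q' : {poly K}) :
  (forall i, Phi p`_i q`_i) -> (forall i, Phi p'`_i q'`_i) ->
  forall i, Phi (p * p')`_i (q * q')`_i.
Proof.
by move=> h h' i; rewrite !coefM; apply: place_sum => j _; apply: placeM.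
Qed.

Lemma place_polyD (p p' : {poly F}) (q q' : {poly K}) :
  (forall i, Phi p`_i q`_i) -> (forall i, Phi p'`_i q'`_i) ->
  forall i, Phi (p + p')`_i (q + q')`_i.
Proof. by move=> h h' i; rewrite !coefD; apply: placeD. Qed.

Lemma place_polyK (q : {poly K}) i : Phi (map_poly iota q)`_i q`_i.
Proof. by rewrite coef_map; apply: placeC. Qed.

(** These reductions form an ideal of K[X], which is principal, and K is
    algebraically closed. *)
Lemma relation_poly_root z : ~ relation_poly z 1 ->
  exists c, forall q, relation_poly z q -> q.[c] = 0.
Proof.
move=> n1; have [all0|/existsNP[q1 /not_implyP[rel1 q10]]] :=
    EM (forall q, relation_poly z q -> q = 0).
  by exists 0 => q /all0 ->; rewrite horner0.
have relM a q : relation_poly z q -> relation_poly z (a * q).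
  move=> [p [hp pz]]; exists (map_poly iota a * p); split.
    by apply: place_polyM => // i; apply: place_polyK.
  by rewrite hornerM pz mulr0.
have relD q q' : relation_poly z q -> relation_poly z q' -> relation_poly z (q + q').
  move=> [p [hp pz]] [p' [hp' pz']]; exists (p + p'); split; first exact: place_polyD.
  by rewrite hornerD pz pz' addr0.
pose good m := `[< exists q, [/\ relation_poly z q, q != 0 & size q = m] >].
have exg : exists m, good m.
  by exists (size q1); apply/asboolP; exists q1; split=> //; apply/eqP.
case: (ex_minnP exg) => m /asboolP[q [relq q0 sq]] minm.
have sq1 : size q != 1%N.
  apply/eqP => /eqP/size_poly1P[a a0 qa]; apply: n1.
  have -> : 1 = (a^-1)%:P * q by rewrite qa -polyCM mulVf.
  exact: relM.
have [c /rootP qc] := closed_rootP _ sq1.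
exists c => q' relq'; rewrite (divp_eq q' q) hornerD hornerM qc mulr0 add0r.
suff -> : q' %% q = 0 by rewrite horner0.
apply/eqP; apply: contrapT => /negP r0.
have relr : relation_poly z (q' %% q).
  have -> : q' %% q = q' + (- (q' %/ q)) * q.
    by rewrite {2}(divp_eq q' q) mulNr addrAC subrr add0r.
  by apply: relD => //; apply: relM.
have := minm (size (q' %% q)); rewrite -sq leqNgt ltn_modp q0 => H.
by apply/notF/H/asboolP; exists (q' %% q).
Qed.

Lemma adjoin_place z c : (forall q, relation_poly z q -> q.[c] = 0) ->
  [/\ partial_place (adjoin z c), forall x d, Phi x d -> adjoin z c x d
    & adjoin z c z c].
Proof.
move=> hc; have sub x d : Phi x d -> adjoin z c x d.
  by exists x%:P, d%:P; rewrite !hornerC; split=> // i; apply: place_polyC.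
split=> //.
- split.
  + by move=> d; apply: sub; apply: placeC.
  + move=> x y d e [p [q [h -> ->]]] [p' [q' [h' -> ->]]].
    by exists (p + p'), (q + q'); rewrite !hornerD; split=> //; apply: place_polyD.
  + move=> x y d e [p [q [h -> ->]]] [p' [q' [h' -> ->]]].
    by exists (p * p'), (q * q'); rewrite !hornerM; split=> //; apply: place_polyM.
  + move=> [p [q [h pz qc]]]; have := hc q; rewrite -qc => /(_ _)/eqP.
    by rewrite oner_eq0 => H; apply/notF/H; exists p.
- exists 'X, 'X; rewrite !hornerX; split=> // i; rewrite !coefX.
  by case: eqP => _; [apply: place1 | apply: place0].
Qed.

Lemma relation_poly1P z : relation_poly z 1 ->
  exists k (p : nat -> F), [/\ Phi (p 0) 1, forall i, (0 < i)%N -> Phi (p i) 0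
    & \sum_(i < k.+1) p i * z ^+ i = 0].
Proof.
move=> [p [hp pz]]; exists (size p), (fun i => p`_i); split.
- by have := hp 0%N; rewrite coef1.
- by case=> // i _; have := hp i.+1; rewrite coef1.
- by move: pz; rewrite (horner_coef_wide _ (leqnSn _)).
Qed.

(** Chevalley's lemma.  Let p_0 + p_1 z + ... + p_k z^k = 0 and
    q_0 + q_1 z^-1 + ... + q_l z^-l = 0, where the place sends p_0 and q_0 to 1 and the
    other coefficients to 0, and let l <= k.  Subtracting p_k z^k times the second
    relation from q_0 times the first gives a relation of the first kind with a
    smaller k, until a constant relation contradicts [place01]. *)
Lemma not_both_relations z : z != 0 -> relation_poly z 1 -> relation_poly z^-1 1 -> False.
Proof.
move=> z0 /relation_poly1P[k [p [p0 pS pz]]] /relation_poly1P[l [q [q0 qS qz]]].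
have [s] := ubnP (k + l); elim: s => // s IH in z z0 k l p q p0 pS pz q0 qS qz *.
rewrite ltnS => les; wlog lelk : z z0 k l p q p0 pS pz q0 qS qz les / (l <= k)%N.
  move=> W; have [le|/ltnW le] := leqP l k; first exact: (W z _ k l p q).
  by apply: (W z^-1 _ l k q p) => //; rewrite ?invr_eq0 ?invrK // 1?addnC.
case: l => [|l] in q qz q0 les lelk qS *.
  by apply: (place01 PhiP); move: qz q0; rewrite big_ord1 expr0 mulr1 => ->.
case: k => // k in p pz p0 pS les lelk *.
(* The top coefficient of p is cancelled against the constant term of q. *)
pose q' i := if (k - l <= i <= k.+1)%N then q (k.+1 - i)%N else 0.
have q'z : \sum_(i < k.+2) q' i * z ^+ i = 0.
  have -> : \sum_(i < k.+2) q' i * z ^+ i =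
            z ^+ k.+1 * \sum_(i < l.+2) q i * z^-1 ^+ i.
    rewrite (reindex_inj rev_ord_inj) /= mulr_sumr.
    rewrite (big_ord_widen k.+2 (fun i => z ^+ k.+1 * (q i * z^-1 ^+ i))) //.
    rewrite [RHS]big_mkcond /=; apply: eq_bigr => i _.
    have ik : (i <= k.+1)%N by rewrite -ltnS.
    rewrite /q' subSS subKn // leq_subr andbT.
    have -> : (k - l <= k.+1 - i)%N = (i < l.+2)%N by lia.
    case: ifP => _; last by rewrite mul0r.
    have -> : z ^+ k.+1 = z ^+ (k.+1 - i) * z ^+ i by rewrite -exprD subnK.
    by rewrite exprVn mulrCA mulfK ?expf_neq0.
  by rewrite qz mulr0.
pose p' i := q 0%N * p i - p k.+1 * q' i.
apply: (IH z z0 k l.+1 p' q) => //.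
- have h : Phi (p k.+1 * q' 0%N) (0 * 0).
    apply: placeM => //; first exact: pS.
    by rewrite /q'; case: ifP => _; [apply: qS | apply: place0].
  by have := placeD PhiP (placeM PhiP q0 p0) (placeN h); rewrite !mulr0 mulr1 subr0.
- move=> i i0; have [->|ne] := eqVneq i k.+1.
    by rewrite /p' /q' leqnn (leqW (leq_subr l k)) /= subnn mulrC subrr; apply: place0.
  have h : Phi (p k.+1 * q' i) (0 * 0).
    apply: placeM => //; first exact: pS.
    rewrite /q'; case: ifP => [/andP[_ ik]|_]; last exact: place0.
    by apply: qS; rewrite subn_gt0 ltn_neqAle ne.
  by have := placeD PhiP (placeM PhiP q0 (pS i i0)) (placeN h); rewrite !mulr0 subr0.
- have : \sum_(i < k.+2) p' i * z ^+ i = 0.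
    rewrite /p'; under eq_bigr do rewrite mulrBl -!mulrA.
    by rewrite sumrB -!mulr_sumr pz q'z !mulr0 subr0.
  rewrite big_ord_recr /=; suff -> : p' k.+1 = 0 by rewrite mul0r addr0.
  by rewrite /p' /q' leqnn (leqW (leq_subr l k)) /= subnn mulrC subrr.
Qed.

End Basics.
End Places.

(** * Extending places and characters *)

Section PlaceExtensions.
Variables (K : closedFieldType) (F : fieldType) (iota : {rmorphism K -> F}).

(** By Chevalley's lemma, z or 1/z can be adjoined, for each z in turn. *)
Lemma place_decide Phi (s : seq F) : partial_place iota Phi -> {in s, forall z, z != 0} ->
  exists Phi', [/\ partial_place iota Phi', forall x c, Phi x c -> Phi' x c
    & {in s, forall z, (exists c, Phi' z c) \/ (exists c, Phi' z^-1 c)}].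
Proof.
elim: s Phi => [|z s IH] Phi PhiP s0; first by exists Phi.
have z0 : z != 0 by apply: s0; rewrite mem_head.
have [y [c [yz [P1 sub1 P1y]]]] : exists y c, (y = z \/ y = z^-1) /\
    [/\ partial_place iota (adjoin Phi y c), forall x d, Phi x d -> adjoin Phi y c x d
      & adjoin Phi y c y c].
  have [nz|/contrapT rz] := EM (~ relation_poly Phi z 1).
    have [c hc] := relation_poly_root PhiP nz.
    by exists z, c; split; [left | apply: adjoin_place].
  have nz : ~ relation_poly Phi z^-1 1 by move=> h; apply: (not_both_relations PhiP z0 rz h).
  have [c hc] := relation_poly_root PhiP nz.
  by exists z^-1, c; split; [right | apply: adjoin_place].
have [|Phi' [P' sub' dec']] := IH _ P1.
  by move=> x xs; apply: s0; rewrite inE xs orbT.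
exists Phi'; split=> // [x d /sub1 /sub' //|x].
rewrite inE => /orP[/eqP ->|/dec' //].
by case: yz => e; [left | right]; exists c; rewrite -e; apply: sub'.
Qed.

(** Localization at the complement of the kernel. *)
Lemma place_localize Phi : partial_place iota Phi ->
  exists Phi', [/\ partial_place iota Phi', forall x c, Phi x c -> Phi' x c
    & forall x c, Phi' x c -> c != 0 -> Phi' x^-1 c^-1].
Proof.
move=> PhiP; exists (fun x c => exists y d, [/\ d != 0, Phi y d & Phi (x * y) (c * d)]).
split.
- split.
  + move=> c; exists 1, 1; rewrite oner_neq0 !mulr1; split=> //; last exact: placeC.
    exact: place1 PhiP.
  + move=> x y c d [x' [c' [c0 hx hx']]] [y' [d' [d0 hy hy']]].
    exists (x' * y'), (c' * d'); split; [exact: mulf_neq0 | exact: (placeM PhiP) |].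
    rewrite !mulrDl mulrA [c * _]mulrA mulrCA [d * _]mulrCA.
    by apply: (placeD PhiP); apply: (placeM PhiP).
  + move=> x y c d [x' [c' [c0 hx hx']]] [y' [d' [d0 hy hy']]].
    exists (x' * y'), (c' * d'); split; [exact: mulf_neq0 | exact: (placeM PhiP) |].
    by rewrite mulrACA [c * _ * _]mulrACA; apply: (placeM PhiP).
  + move=> [y [d [d0 _]]]; rewrite mul0r mul1r => h.
    by move: d0; rewrite (place_fun PhiP h (place0 PhiP)) eqxx.
- by move=> x c h; exists 1, 1; rewrite oner_neq0 !mulr1; split=> //; apply: place1 PhiP.
- move=> x c [y [d [d0 hy hxy]]] c0; exists (x * y), (c * d).
  split=> //; first exact: mulf_neq0.
  rewrite [c^-1 * _]mulKf //; have [x0|x0] := eqVneq x 0; last by rewrite mulKf.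
  move: hxy; rewrite x0 mul0r => /(place_fun PhiP (place0 PhiP))/esym/eqP.
  by rewrite mulf_eq0 (negPf c0) (negPf d0).
Qed.

(** The graph of a morphism to K^* from a subgroup of F^*. *)
Record partial_character (Psi : F -> K -> Prop) : Prop := PartialCharacter {
  char1 : Psi 1 1;
  charM : forall x y c d, Psi x c -> Psi y d -> Psi (x * y) (c * d);
  charV : forall x c, Psi x c -> Psi x^-1 c^-1;
  char_neq0 : forall x c, Psi x c -> x != 0 /\ c != 0;
  char1_eq1 : forall c, Psi 1 c -> c = 1 }.

Lemma charXz Psi : partial_character Psi -> forall x c (k : int),
  Psi x c -> Psi (x ^ k) (c ^ k).
Proof.
move=> PsiP x c k h.
have hn m : Psi (x ^+ m) (c ^+ m).
  elim: m => [|m IH]; first by rewrite !expr0; apply: char1.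
  by rewrite !exprS; apply: charM.
by case: k => m; [rewrite -!exprnP | rewrite NegzE -!exprnN; apply: charV].
Qed.

Lemma char_fun Psi x c d : partial_character Psi -> Psi x c -> Psi x d -> c = d.
Proof.
move=> PsiP hc hd; have [x0 c0] := char_neq0 PsiP hc; have [_ d0] := char_neq0 PsiP hd.
have := charM PsiP hc (charV PsiP hd); rewrite divff // => /(char1_eq1 PsiP) e.
by rewrite -[c](divfK d0) e mul1r.
Qed.

(** The powers of z in the domain of the character are those of some z^k; the value
    at z is a k-th root of the value at z^k, or any nonzero element if k = 0. *)
Lemma character_extend Psi z : partial_character Psi -> z != 0 ->
  exists Psi' c, [/\ partial_character Psi', forall x d, Psi x d -> Psi' x d & Psi' z c].
Proof.
move=> PsiP z0.
have [c [c0 hc]] : exists c : K, c != 0 /\ forall (k : int) d, Psi (z ^ k) d -> d = c ^ k.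
  pose good k := (0 < k)%N && `[< exists d, Psi (z ^+ k) d >].
  have [exk|nok] := EM (exists k, good k); last first.
    exists 1; split; rewrite ?oner_neq0 // => k d hk; rewrite exp1rz.
    case: k hk => [[|k]|k] hk.
    - by move: hk; rewrite expr0z => /(char1_eq1 PsiP).
    - by case: nok; exists k.+1; apply/andP; split=> //; apply/asboolP; exists d.
    - case: nok; exists k.+1; apply/andP; split=> //; apply/asboolP; exists d^-1.
      have := charV PsiP hk; rewrite NegzE -exprnN invrK; exact.
  case: (ex_minnP exk) => k /andP[k0 /asboolP[d hd]] mink.
  have [_ d0] := char_neq0 PsiP hd.
  have [c ck] : exists c : K, c ^+ k = d.
    have : size ('X^k - d%:P : {poly K}) != 1%N by rewrite size_XnsubC // eqSS -lt0n.
    move=> /closed_rootP[c]; rewrite rootE !hornerE subr_eq0 => /eqP e.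
    by exists c; rewrite -e ?hornerXn.
  have c0 : c != 0 by apply: contraNneq d0 => e; rewrite -ck e expr0n gtn_eqF.
  exists c; split=> // m e he.
  pose q := (m %/ k)%Z; pose r := (m %% k)%Z.
  have em : m = r + (k : int) * q by rewrite /r addrC mulrC -divz_eq.
  have r0 : 0 <= r by apply: modz_ge0; rewrite -lt0n.
  have rk : r < k by apply: ltz_pmod.
  have hr : Psi (z ^ r) (e * (d ^ q)^-1).
    have := charM PsiP he (charV PsiP (charXz PsiP q hd)).
    have -> : (z ^+ k) ^ q = z ^ ((k : int) * q) by rewrite exprnP exprz_exp.
    by rewrite em expfzDr // mulfK // expfz_neq0.
  have rz : r = 0.
    case: r r0 rk hr {em} => // [[|r]] // _ rk hr.
    have rk' : (r.+1 < k)%N by [].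
    suff : (k <= r.+1)%N by rewrite leqNgt rk'.
    by apply: mink; apply/andP; split=> //; apply/asboolP; exists (e * (d ^ q)^-1).
  move: hr; rewrite rz expr0z => /(char1_eq1 PsiP) e1.
  have dq : d ^ q != 0 by apply: expfz_neq0.
  have ckq : c ^ ((k : int) * q) = d ^ q by rewrite -ck exprnP exprz_exp.
  by rewrite em rz add0r ckq -[e](divfK dq) e1 mul1r.
exists (fun x d => exists k : int, Psi (x * z ^ k) (d * c ^ k)), c; split.
- split.
  + by exists 0; rewrite !expr0z !mulr1; apply: char1.
  + move=> x y d e [k hk] [l hl]; exists (k + l).
    by rewrite !expfzDr // mulrACA [d * _ * _]mulrACA; apply: charM.
  + move=> x d [k hk]; exists (- k); rewrite -!invr_expz -!invfM.
    exact: charV.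
  + move=> x d [k /(char_neq0 PsiP)[]]; rewrite !mulf_eq0 !negb_or.
    by move=> /andP[-> _] /andP[-> _].
  + move=> d [k]; rewrite mul1r => /hc e.
    by apply: (mulIf (expfz_neq0 k c0)); rewrite mul1r.
- by move=> x d h; exists 0; rewrite !expr0z !mulr1.
- by exists (-1); rewrite -!invr_expz !expr1z !divff //; apply: char1.
Qed.

Lemma character_extend_seq (n : nat) (z : 'I_n -> F) Psi :
  partial_character Psi -> (forall i, z i != 0) ->
  exists Psi' b, [/\ partial_character Psi', forall x d, Psi x d -> Psi' x d
    & forall i, Psi' (z i) (b i)].
Proof.
move=> PsiP z0.
suff [Psi' [P' sub' h]] : exists Psi', [/\ partial_character Psi',
    forall x d, Psi x d -> Psi' x d & forall i, i \in enum 'I_n -> exists b, Psi' (z i) b].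
  have /choice[b hb] : forall i, exists b, Psi' (z i) b by move=> i; apply: h; rewrite mem_enum.
  by exists Psi', b.
elim: (enum 'I_n) => [|i s [Psi1 [P1 sub1 h1]]]; first by exists Psi.
have [Psi' [b [P' sub' hb]]] := character_extend P1 (z0 i).
exists Psi'; split=> // [x d /sub1 /sub' //|k].
by rewrite inE => /orP[/eqP ->|/h1[c /sub' hc]]; [exists b | exists c].
Qed.

End PlaceExtensions.

(** * Fourier-Motzkin elimination and integral weights *)

Section FourierMotzkin.

Definition bounded_below (s : bool) (x y : rat) : Prop := if s then x < y else x <= y.

Lemma bounded_belowW s x y : bounded_below s x y -> x <= y.
Proof. by case: s => //= /ltW. Qed.

Lemma seq_maximum (R : realDomainType) (T : eqType) (f : T -> R) x (s : seq T) :
  exists2 m, m \in x :: s & forall y, y \in x :: s -> f y <= f m.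
Proof.
elim: s x => [|y s IH] x; first by exists x; rewrite ?mem_head // => y; rewrite inE => /eqP ->.
have [m ms hm] := IH y; have [le|lt] := leP (f x) (f m).
  exists m; first by rewrite inE ms orbT.
  move=> k; rewrite inE => /orP[/eqP ->//|].
  exact: hm.
exists x; rewrite ?mem_head // => k; rewrite inE => /orP[/eqP ->//|/hm h].
exact: le_trans h (ltW lt).
Qed.

Lemma seq_minimum (R : realDomainType) (T : eqType) (f : T -> R) x (s : seq T) :
  x \in s -> exists2 m, m \in s & forall y, y \in s -> f m <= f y.
Proof.
case: s => // y s _; have [m ms hm] := seq_maximum (fun k => - f k) y s.
by exists m => // k /hm; rewrite lerN2.
Qed.

(** One-dimensional Helly: the midpoint between the greatest lower bound and the
    least upper bound also satisfies the strict constraints. *)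
Lemma interval_point (Lo Hi : seq (bool * rat)) :
  (forall x y, x \in Lo -> y \in Hi -> bounded_below (x.1 || y.1) x.2 y.2) ->
  exists t, (forall x, x \in Lo -> bounded_below x.1 x.2 t) /\
            (forall y, y \in Hi -> bounded_below y.1 t y.2).
Proof.
case: Lo => [|x0 Lo]; case: Hi => [|y0 Hi] compat.
- by exists 0.
- have [m _ hm] := seq_minimum (fun y : bool * rat => y.2) (mem_head y0 Hi).
  exists (m.2 - 1); split=> // y /hm le.
  by rewrite /bounded_below; case: ifP => _; lra.
- have [m _ hm] := seq_maximum (fun y : bool * rat => y.2) x0 Lo.
  exists (m.2 + 1); split=> // y /hm le.
  by rewrite /bounded_below; case: ifP => _; lra.
- have [M Min hM] := seq_maximum (fun y : bool * rat => y.2) x0 Lo.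
  have [m mIn hm] := seq_minimum (fun y : bool * rat => y.2) (mem_head y0 Hi).
  have := compat _ _ Min mIn => /bounded_belowW Mm.
  exists ((M.2 + m.2) / 2%:R); split=> [x xin|y yin].
    have := hM x xin; have := compat x m xin mIn.
    by rewrite /bounded_below; case: x.1 => /= ? ?; lra.
  have := hm y yin; have := compat M y Min yin; rewrite orbC.
  by rewrite /bounded_below; case: y.1 => /= ? ?; lra.
Qed.

Variables (n : nat) (C : bool -> {ffun 'I_n -> int} -> Prop).
Hypothesis C0 : ~ C true 0.
Hypothesis CD : forall s t a b, C s a -> C t b -> C (s || t) (a + b).

Definition pairing (u : 'I_n -> rat) (a : {ffun 'I_n -> int}) : rat :=
  \sum_i u i * (a i)%:~R.

Lemma cone_mul s a k : C s a -> (0 < k)%N -> C s (a *+ k).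
Proof.
move=> h; elim: k => // -[|k] IH _; first by rewrite mulr1n.
by rewrite mulrS -[s]orbb; apply: CD => //; apply: IH.
Qed.

Lemma pairing_split (u : 'I_n -> rat) i t a :
  pairing (fun k => if k == i then t else u k) a =
  t * (a i)%:~R + \sum_(k | k != i) u k * (a k)%:~R.
Proof.
rewrite /pairing (bigD1 i) //= eqxx; congr (_ + _).
by apply: eq_bigr => k /negPf ->.
Qed.

Lemma cancel_opposite_signs (a b : int) : 0 < a -> b < 0 ->
  a *+ `|b|%N + b *+ `|a|%N = 0.
Proof.
move=> a0 b0; rewrite -[a *+ _]mulr_natr -[b *+ _]mulr_natr !natz !abszE.
rewrite (ltr0_norm b0) (gtr0_norm a0).
by rewrite mulrN mulrC addNr.
Qed.

(** C true and C false play the role of the positive and of the nonnegative vectors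
    of a cone.  Instead of excluding nonnegative relations between the given vectors,
    it is enough that C is additive and that 0 is not positive: both properties
    pass to the combinations formed by elimination. *)
Lemma separating_functional (X : seq (bool * {ffun 'I_n -> int})) :
  (forall x, x \in X -> C x.1 x.2) ->
  exists u, forall x, x \in X -> bounded_below x.1 0 (pairing u x.2).
Proof.
move=> XC; suff main (l : seq 'I_n) : forall X : seq (bool * {ffun 'I_n -> int}),
    (forall x, x \in X -> C x.1 x.2) ->
    (forall x i, x \in X -> i \notin l -> x.2 i = 0) ->
    exists u, forall x, x \in X -> bounded_below x.1 0 (pairing u x.2).
  by apply: (main (enum 'I_n)) => // x i _; rewrite mem_enum.
elim: l => [|i l IH] {XC}X XC Xl.
  exists (fun=> 0) => x xX; have x0 : x.2 = 0.
    by apply/ffunP => i; rewrite ffunE; apply: Xl.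
  have := XC x xX; rewrite x0 /pairing big1 => [|k _]; last by rewrite mul0r.
  by case: x.1.
(* Pairs of vectors with opposite signs in coordinate i are combined so as to
   cancel that coordinate. *)
pose Xz := [seq x : bool * {ffun 'I_n -> int} <- X | x.2 i == 0].
pose Xp := [seq x : bool * {ffun 'I_n -> int} <- X | 0 < x.2 i].
pose Xn := [seq x : bool * {ffun 'I_n -> int} <- X | x.2 i < 0].
pose comb (x y : bool * {ffun 'I_n -> int}) :=
  (x.1 || y.1, x.2 *+ `|y.2 i|%N + y.2 *+ `|x.2 i|%N).
have [||u hu] := IH (Xz ++ [seq comb x y | x <- Xp, y <- Xn]).
- move=> x; rewrite mem_cat => /orP[|/allpairsP[[a b] /= [aX bX ->]] /=].
    by rewrite mem_filter => /andP[_ /XC].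
  move: aX bX; rewrite !mem_filter => /andP[a0 /XC aC] /andP[b0 /XC bC].
  by apply: CD; apply: cone_mul => //; rewrite absz_gt0; [apply: ltr0_neq0|apply: lt0r_neq0].
- move=> x k; rewrite mem_cat => /orP[|/allpairsP[[a b] /= [aX bX ->]] /=].
    rewrite mem_filter => /andP[/eqP xi xX] kl.
    by have [->//|ki] := eqVneq k i; apply: Xl; rewrite // inE negb_or ki.
  move: aX bX; rewrite !mem_filter => /andP[a0 aX] /andP[b0 bX] kl.
  rewrite !ffunE !ffunMnE; have [->|ki] := eqVneq k i; first exact: cancel_opposite_signs.
  by rewrite (Xl a k) ?(Xl b k) ?mul0rn ?addr0 // inE negb_or ki.
pose d (a : {ffun 'I_n -> int}) := \sum_(k | k != i) u k * (a k)%:~R : rat.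
have [|t [tlo thi]] := @interval_point
    [seq (x.1, - d x.2 / (x.2 i)%:~R) | x <- Xp]
    [seq (y.1, d y.2 / (- (y.2 i)%:~R)) | y <- Xn].
  move=> _ _ /mapP[x xX ->] /mapP[y yX ->] /=.
  have := hu (comb x y); rewrite mem_cat allpairs_f ?orbT // => /(_ isT) /=.
  move: xX yX; rewrite !mem_filter => /andP[x0 xX] /andP[y0 yX].
  have X0 : 0 < (x.2 i)%:~R :> rat by rewrite ltr0z.
  have Y0 : 0 < - (y.2 i)%:~R :> rat by rewrite oppr_gt0 ltrz0.
  have -> : pairing u (x.2 *+ `|y.2 i| + y.2 *+ `|x.2 i|) =
            - (y.2 i)%:~R * d x.2 + (x.2 i)%:~R * d y.2.
    rewrite /pairing (bigD1 i) //= {1}[in X in _ * X]ffunE !ffunMnE.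
    have -> : x.2 i *+ `|y.2 i| + y.2 i *+ `|x.2 i| = 0
      by exact: cancel_opposite_signs.
    rewrite mulr0 add0r /d !mulr_sumr -big_split /=; apply: eq_bigr => k _.
    rewrite ffunE !ffunMnE rmorphD !rmorphMn /=.
    rewrite -[(x.2 k)%:~R *+ _]mulr_natl -[(y.2 k)%:~R *+ _]mulr_natl.
    have -> : `|y.2 i|%:R = - (y.2 i)%:~R :> rat.
      by rewrite -rmorphN /= -[in RHS](ltr0_norm y0) pmulrn abszE.
    have -> : `|x.2 i|%:R = (x.2 i)%:~R :> rat.
      by rewrite -[in RHS](gtr0_norm x0) pmulrn abszE.
    ring.
  by rewrite /bounded_below; case: (_ || _) => /=; rewrite ?ltr_pdivrMr ?ler_pdivrMr // mulrAC
     ?ltr_pdivlMr ?ler_pdivlMr // => ?; lra.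
exists (fun k => if k == i then t else u k) => x xX; rewrite pairing_split -/(d x.2).
have [xi|xi|xi] := ltrgtP (x.2 i) 0.
- have := thi (x.1, d x.2 / (- (x.2 i)%:~R)) (map_f _ _); rewrite mem_filter xi.
  have Y0 : 0 < - (x.2 i)%:~R :> rat by rewrite oppr_gt0 ltrz0.
  move=> /(_ xX) /=; rewrite /bounded_below.
  case: x.1 => /=; rewrite ?ltr_pdivlMr ?ler_pdivlMr // => ?; lra.
- have := tlo (x.1, - d x.2 / (x.2 i)%:~R) (map_f _ _); rewrite mem_filter xi.
  have X0 : 0 < (x.2 i)%:~R :> rat by rewrite ltr0z.
  move=> /(_ xX) /=; rewrite /bounded_below.
  case: x.1 => /=; rewrite ?ltr_pdivrMr ?ler_pdivrMr // => ?; lra.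
- have := hu x; rewrite mem_cat mem_filter xi eqxx xX => /(_ isT).
  by rewrite /pairing (bigD1 i) //= xi !mulr0.
Qed.

Lemma clear_denominators (u : 'I_n -> rat) :
  exists (w : 'I_n -> int) (D : int), 0 < D /\ forall i, (w i)%:~R = D%:~R * u i.
Proof.
exists (fun i => numq (u i) * \prod_(k | k != i) denq (u k)), (\prod_k denq (u k)).
split=> [|i]; first by apply: prodr_gt0 => k _; apply: denq_gt0.
rewrite [X in _ = X%:~R * _](bigD1 i) //= !rmorphM /= [in RHS]mulrC mulrA; congr (_ * _).
by rewrite numqE.
Qed.

Lemma separating_weight (X : seq (bool * {ffun 'I_n -> int})) :
  (forall x, x \in X -> C x.1 x.2) ->
  exists w : 'I_n -> int, forall x, x \in X ->
    if x.1 then 0 < \sum_i w i * x.2 i else 0 <= \sum_i w i * x.2 i.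
Proof.
move=> /separating_functional[u hu]; have [w [D [D0 wE]]] := clear_denominators u.
exists w => x /hu; suff -> : pairing u x.2 = D%:~R^-1 * (\sum_i w i * x.2 i)%:~R.
  by rewrite /bounded_below; case: x.1 => /=; rewrite ?pmulr_rgt0 ?pmulr_rge0 ?invr_gt0 ?ltr0z ?ler0z.
rewrite rmorph_sum /= mulr_sumr; apply: eq_bigr => i _.
by rewrite rmorphM /= wE mulrA mulKf // intr_eq0 gt_eqF.
Qed.

End FourierMotzkin.

(** * Weights and leading coefficients from a place *)

Section LaurentMonomials.
Variables (F : fieldType) (n : nat) (z : 'I_n -> F).
Hypothesis z0 : forall i, z i != 0.

Definition lmonom (a : {ffun 'I_n -> int}) : F := \prod_i z i ^ a i.

Definition expo (m : 'X_{1..n}) : {ffun 'I_n -> int} := [ffun i => (m i : int)].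

Lemma lmonomD a b : lmonom (a + b) = lmonom a * lmonom b.
Proof.
by rewrite /lmonom -big_split /=; apply: eq_bigr => i _; rewrite ffunE expfzDr.
Qed.

Lemma lmonom0 : lmonom 0 = 1.
Proof. by rewrite /lmonom big1 // => i _; rewrite ffunE expr0z. Qed.

Lemma lmonom_neq0 a : lmonom a != 0.
Proof. by apply/prodf_neq0 => i _; apply: expfz_neq0. Qed.

Lemma lmonomN a : lmonom (- a) = (lmonom a)^-1.
Proof.
by apply: (mulfI (lmonom_neq0 a)); rewrite -lmonomD subrr lmonom0 divff ?lmonom_neq0.
Qed.

Lemma lmonom_expo m : lmonom (expo m) = mmap1 z m.
Proof. by apply: eq_bigr => i _; rewrite ffunE -exprnP. Qed.

Lemma lmonomB m m' : lmonom (expo m - expo m') = mmap1 z m / mmap1 z m'.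
Proof. by rewrite lmonomD lmonomN !lmonom_expo. Qed.

Lemma lmonomU i : lmonom (expo U_(i)) = z i.
Proof. by rewrite lmonom_expo mmap1U. Qed.

End LaurentMonomials.

Lemma weight_of_setT n (w : 'I_n -> int) m :
  weight_of [set: 'I_n] w m = \sum_i w i * expo m i.
Proof.
rewrite /weight_of big_mkcond /=; apply: eq_bigr => i _.
by rewrite inE ffunE -mulr_natr natz.
Qed.

Section WeightsOfPlace.
Variables (K : closedFieldType) (F : fieldType) (iota : {rmorphism K -> F}).
Variables (Phi : F -> K -> Prop) (PhiP : partial_place iota Phi).
Variables (n : nat) (z : 'I_n -> F).
Hypothesis z0 : forall i, z i != 0.

Local Notation vec := {ffun 'I_n -> int}.

(** After an extension, the place takes the value 0, infinity or a unit at each of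
    finitely many Laurent monomials in z.  The first kind form the strict constraints
    of [separating_weight], the third kind the equalities (two weak constraints each);
    the leading coefficients b extend the character given by the third kind. *)
Lemma place_weights (G : seq vec) :
  exists (Phi' : F -> K -> Prop) (u : 'I_n -> int) (b : 'I_n -> K),
  [/\ partial_place iota Phi', forall x c, Phi x c -> Phi' x c, forall i, b i != 0 &
  forall a, a \in G ->
    [\/ Phi' (lmonom z a) 0 /\ 0 < \sum_i u i * a i,
        Phi' (lmonom z a)^-1 0 /\ \sum_i u i * a i < 0 |
        Phi' (lmonom z a) (lmonom b a) /\ \sum_i u i * a i = 0]].
Proof.
have [|Phi1 [P1 sub1 dec1]] := place_decide (s := map (lmonom z) G) PhiP.
  by move=> _ /mapP[a _ ->]; apply: lmonom_neq0.
have [Phi2 [P2 sub2 inv2]] := place_localize P1.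
pose C s (a : vec) := if s then Phi2 (lmonom z a) 0
                      else exists c, c != 0 /\ Phi2 (lmonom z a) c.
have C0 : ~ C true 0.
  rewrite /C lmonom0 => /(place_fun P2 (place1 P2))/eqP.
  by rewrite oner_eq0.
have CD s t a b : C s a -> C t b -> C (s || t) (a + b).
  rewrite /C; case: s t => [] [] /=; rewrite lmonomD //.
  - by move=> ha hb; rewrite -(mulr0 0); apply: (placeM P2).
  - by move=> ha [c [_ hb]]; rewrite -(mul0r c); apply: (placeM P2).
  - by move=> [c [_ ha]] hb; rewrite -(mulr0 c); apply: (placeM P2).
  - move=> [c [c0 ha]] [d [d0 hb]]; exists (c * d).
    by rewrite mulf_neq0 //; split=> //; apply: (placeM P2).
have CN a : C false a -> C false (- a).
  by move=> [c [c0 h]]; exists c^-1; rewrite invr_eq0 lmonomN //; split=> //; apply: inv2.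
pose G2 := G ++ [seq - a | a <- G].
pose X : seq (bool * vec) := 
  [seq x : bool * vec <- [seq (s, a) | s <- [:: true; false], a <- G2] | `[< C x.1 x.2 >]].
have inX s a : a \in G2 -> C s a -> (s, a) \in X.
  move=> aG h; rewrite mem_filter; apply/andP; split; first exact/asboolP.
  by apply/allpairsP; exists (s, a); split=> //=; case: (s).
have [|u hu] := separating_weight C0 CD (X := X).
  by move=> x; rewrite mem_filter => /andP[/asboolP].
have G2l a : a \in G -> a \in G2 by rewrite mem_cat => ->.
have G2r a : a \in G -> - a \in G2 by rewrite mem_cat orbC => aG; rewrite map_f.
have sumN a : \sum_i u i * (- a : vec) i = - \sum_i u i * a i.
  by rewrite -sumrN; apply: eq_bigr => i _; rewrite ffunE mulrN.
have Psi0 : partial_character (fun x c => [/\ x != 0, c != 0 & Phi2 x c]).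
  split.
  - by rewrite !oner_neq0; split=> //; apply: (place1 P2).
  - by move=> x y c d [x0 c0 h] [y0 d0 h']; rewrite !mulf_neq0 //; split=> //; apply: (placeM P2).
  - by move=> x c [x0 c0 h]; rewrite !invr_eq0; split=> //; apply: inv2.
  - by move=> x c [].
  - by move=> c [_ _ h]; apply: (place_fun P2 h (place1 P2)).
have [Psi [b [PsiP subPsi hb]]] := character_extend_seq Psi0 z0.
exists Phi2, u, b; split=> // [x c /sub1 /sub2 //|i|a aG].
  by have [] := char_neq0 PsiP (hb i).
have unit c : c != 0 -> Phi2 (lmonom z a) c ->
    Phi2 (lmonom z a) (lmonom b a) /\ \sum_i u i * a i = 0.
  move=> c0 hc; have Ca : C false a by exists c.
  have hba : Psi (lmonom z a) (lmonom b a).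
    rewrite /lmonom; elim/big_rec2: _ => [|i x y _ h]; first exact: (char1 PsiP).
    by apply: (charM PsiP) => //; apply: (charXz PsiP).
  have <- : c = lmonom b a.
    by apply: (char_fun PsiP _ hba); apply: subPsi; split=> //; apply: lmonom_neq0.
  split=> //; apply/eqP; rewrite eq_le.
  have := hu _ (inX false _ (G2l a aG) Ca); have := hu _ (inX false _ (G2r a aG) (CN a Ca)).
  by rewrite /= sumN oppr_ge0 => -> ->.
have [[c hc]|[c hc]] := dec1 _ (map_f (lmonom z) aG).
  have [c0|c0] := eqVneq c 0; last by apply: Or33; apply: (unit c c0); apply: sub2.
  have Ca : C true a by rewrite c0 in hc; apply: sub2.
  by apply: Or31; split=> //; apply: (hu _ (inX true _ (G2l a aG) Ca)).
have [c0|c0] := eqVneq c 0.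
  have Ca : C true (- a) by rewrite c0 in hc; rewrite /C lmonomN //; apply: sub2.
  apply: Or32; split; first by rewrite -lmonomN.
  by have := hu _ (inX true _ (G2r a aG) Ca); rewrite /= sumN oppr_gt0.
apply: Or33; apply: (unit c^-1); first by rewrite invr_eq0.
by rewrite -[lmonom z a]invrK; apply: inv2 => //; apply: sub2.
Qed.

(** Divide p_j(z) by a monomial z^d0 of least weight: the place maps the terms of
    least weight to the terms of the initial form divided by b^d0, and the others to 0.
    The hypothesis gives the value 0 to p_j(z) / z^d0, because z^d / z^d0 is finite. *)
Lemma place_initial_zero m (p : 'I_m -> {mpoly K[n]}) :
  (forall j, p j != 0 -> exists2 d, d \in msupp (p j) &
     Phi (mmap iota z (p j) / mmap1 z d) 0) ->
  exists (u : 'I_n -> int) (b : 'I_n -> K),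
  [/\ forall i, b i != 0,
      forall i, [/\ Phi (z i) 0 -> 0 < u i, Phi (z i)^-1 0 -> u i < 0 &
                    forall c, c != 0 -> Phi (z i) c -> u i = 0] &
      forall j, (In [set: 'I_n] u (p j)).@[b] = 0].
Proof.
move=> hp.
pose G := [seq expo U_(i) | i <- enum 'I_n] ++
  flatten [seq [seq expo d - expo d' | d <- msupp (p j), d' <- msupp (p j)] | j <- enum 'I_m].
have [Phi' [u [b [P' sub b0 tri]]]] := place_weights G.
exists u, b; split=> //.
- move=> i; have iG : expo U_(i) \in G.
    by rewrite mem_cat; apply/orP; left; apply/mapP; exists i; rewrite ?mem_enum.
  have := tri _ iG; rewrite !lmonomU (bigD1 i) //= big1 => [|k ki]; last first.
    by rewrite ffunE mnm1E eq_sym (negPf ki) mulr0.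
  rewrite ffunE mnm1E eqxx mulr1 addr0 => {}tri.
  have excl x : Phi' x 0 -> Phi' x^-1 0 -> x != 0 -> False.
    move=> h h' x0; have := placeM P' h h'; rewrite divff // mulr0.
    by move=> /(place_fun P' (place1 P'))/eqP; rewrite oner_eq0.
  have b0i := b0 i.
  split=> [/sub h|/sub h|c c0 /sub h]; case: tri => [[h' //]|[h' //]|[h' //]].
  + by case: (excl _ h h').
  + by move: b0i; rewrite (place_fun P' h' h) eqxx.
  + by case: (excl _ h' h).
  + have := placeM P' h h'; rewrite mulVf // mul0r.
    by move=> /(place_fun P' (place1 P'))/eqP; rewrite oner_eq0.
  + by move: c0; rewrite (place_fun P' h h') eqxx.
  + have := placeM P' h h'; rewrite divff // mulr0.
    by move=> /(place_fun P' (place1 P'))/eqP; rewrite oner_eq0.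
move=> j; have [->|pj0] := eqVneq (p j) 0.
  by rewrite /In msupp0 big_nil meval0.
have [d1 d1p hd1] := hp j pj0.
set T := msupp (p j); pose wt := weight_of [set: 'I_n] u.
have wtB d d' : \sum_i u i * (expo d - expo d' : vec) i = wt d - wt d'.
  rewrite /wt !weight_of_setT -sumrB; apply: eq_bigr => i _.
  by rewrite !ffunE mulrBr.
have GB d d' : d \in T -> d' \in T -> expo d - expo d' \in G.
  move=> dT d'T; rewrite mem_cat; apply/orP; right.
  by apply/flatten_mapP; exists j; rewrite ?mem_enum //; apply: allpairs_f.
have [d0 d0T mind0] : exists2 d0, d0 \in T & forall d, d \in T -> wt d0 <= wt d.
  exact: seq_minimum d1p.
have allE d : d \in T -> all (fun d' => wt d <= wt d') T = (wt d == wt d0).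
  move=> dT; rewrite eq_le mind0 // andbT; apply/allP/idP => [|le k /mind0]; first exact.
  exact: le_trans.
have term d : d \in T -> Phi' (iota (p j)@_d * (mmap1 z d / mmap1 z d0))
    (if all (fun d' => wt d <= wt d') T then (p j)@_d * (mmap1 b d / mmap1 b d0) else 0).
  move=> dT; rewrite allE // -!lmonomB //.
  have := tri _ (GB d d0 dT d0T); rewrite wtB subr_gt0 subr_lt0.
  case=> [[h lt]|[h lt]|[h /eqP]].
  - by rewrite gt_eqF // -(mulr0 (p j)@_d); apply: (placeM P') => //; apply: (placeC P').
  - by have := mind0 d dT; rewrite leNgt lt.
  - by rewrite subr_eq0 => ->; apply: (placeM P') => //; apply: (placeC P').
pose S := \sum_(d <- T | all (fun d' => wt d <= wt d') T) (p j)@_d * (mmap1 b d / mmap1 b d0).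
have hS : Phi' (mmap iota z (p j) / mmap1 z d0) S.
  rewrite /mmap mulr_suml /S [X in Phi' _ X]big_mkcond /= big_seq [X in Phi' _ X]big_seq.
  by apply: (place_sum P') => d dT; rewrite -mulrA; apply: term.
have S0 : S = 0.
  have [c hc] : exists c, Phi' (mmap1 z d1 / mmap1 z d0) c.
    rewrite -lmonomB //; have := tri _ (GB d1 d0 d1p d0T); rewrite wtB.
    case=> [[h _]|[_]|[h _]]; [by exists 0 | | by eexists; exact: h].
    by rewrite subr_lt0 ltNge mind0.
  have := placeM P' (sub _ _ hd1) hc; rewrite mul0r.
  have z1 : mmap1 z d1 != 0 by rewrite -lmonom_expo lmonom_neq0.
  by rewrite mulrA divfK // => /(place_fun P' hS).
have bd0 : mmap1 b d0 != 0 by rewrite -lmonom_expo lmonom_neq0.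
rewrite /In raddf_sum /= -/T -/wt.
transitivity (S * mmap1 b d0); last by rewrite S0 mul0r.
rewrite /S mulr_suml; apply: eq_bigr => d _.
by rewrite mevalZ mevalX -mulrA divfK.
Qed.

End WeightsOfPlace.

(** * Restriction to coordinate subspaces *)

Section Restriction.
Variables (K : closedFieldType) (n : nat).
Implicit Types (I J : {set 'I_n}) (p : {mpoly K[n]}) (m : 'X_{1..n}).

Definition supp_in I m : bool := [forall i, (i \notin I) ==> (m i == 0%N)].

Lemma supp_inP I m : reflect (forall i, i \notin I -> m i = 0%N) (supp_in I m).
Proof.
by apply: (iffP forallP) => h i; [move=> /(implyP (h i))/eqP | apply/implyP => /h ->].
Qed.

Lemma supp_inPn I m : reflect (exists2 i, i \notin I & m i != 0%N) (~~ supp_in I m).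
Proof.
apply: (iffP forallPn) => [[i]|[i iI mi]].
  by rewrite negb_imply => /andP[]; exists i.
by exists i; rewrite negb_imply iI.
Qed.

Lemma supp_inS I J m : I \subset J -> supp_in I m -> supp_in J m.
Proof.
move=> /fintype.subsetP IJ /supp_inP h; apply/supp_inP => i iJ.
by apply: h; apply: contra iJ; apply: IJ.
Qed.

Lemma restrE I p : restr I p = \sum_(m <- msupp p | supp_in I m) p@_m *: 'X_[m].
Proof.
rewrite /restr comp_mpolyEX [RHS]big_mkcond; apply: eq_bigr => m _.
rewrite comp_mpolyX; case: ifP => [/supp_inP mI|/negbT/supp_inPn[i iI mi]].
  congr (_ *: _); rewrite mpolyXE_id; apply: eq_bigr => i _; rewrite tnth_mktuple.
  by have [//|/mI ->] := boolP (i \in I); rewrite !expr0.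
rewrite (bigD1 i) //= tnth_mktuple (negPf iI) expr0n (negPf mi) mul0r.
by rewrite scaler0.
Qed.

Lemma mcoeff_restr I p m : (restr I p)@_m = if supp_in I m then p@_m else 0.
Proof.
rewrite restrE raddf_sum /=; under eq_bigr do rewrite mcoeffZ mcoeffX.
have [mp|mp] := boolP (m \in msupp p); last first.
  rewrite memN_msupp_eq0 // if_same big_seq_cond big1 // => k /andP[kp _].
  by have [e|] := eqVneq k m; [rewrite -e kp in mp | rewrite mulr0].
rewrite big_mkcond (bigD1_seq m) ?msupp_uniq //= eqxx mulr1 big1 ?addr0 // => k /negPf ->.
by rewrite mulr0 if_same.
Qed.

Lemma msupp_restr I p m : (m \in msupp (restr I p)) = supp_in I m && (m \in msupp p).
Proof. by rewrite !mcoeff_msupp mcoeff_restr; case: ifP => // _; rewrite eqxx. Qed.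

Lemma perm_msupp_restr I p :
  perm_eq (msupp (restr I p)) [seq m <- msupp p | supp_in I m].
Proof.
apply: uniq_perm; rewrite ?filter_uniq ?msupp_uniq // => m.
by rewrite msupp_restr mem_filter.
Qed.

Lemma mmap_restr (S : comNzRingType) (h : {rmorphism K -> S}) (v : 'I_n -> S) I p :
  mmap h v (restr I p) = \sum_(m <- msupp p | supp_in I m) h p@_m * mmap1 v m.
Proof.
rewrite restrE raddf_sum; apply: eq_bigr => m _.
by rewrite -[LHS]/(mmap h v (_ *: _)) mmapZ mmapX.
Qed.

Lemma restr_eq0S I J p : I \subset J -> restr J p = 0 -> restr I p = 0.
Proof.
move=> IJ J0; apply/mpolyP => m; rewrite mcoeff_restr mcoeff0; case: ifP => // mI.
by have := mcoeff_restr J p m; rewrite J0 mcoeff0 (supp_inS IJ mI) => <-.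
Qed.

End Restriction.

Definition nonvanishing (K : closedFieldType) n m (f : 'I_m -> {mpoly K[n]})
  (I : {set 'I_n}) : {set 'I_m} := [set j | restr I (f j) != 0].

(** The exponents are nonnegative, so a convex combination of them lies in R^I only if
    every exponent with nonzero weight does. *)
Lemma NPI_nonvanishing (R : realType) (K : closedFieldType) n
    (P : 'I_n -> set 'rV[R]_n) (f : 'I_n -> {mpoly K[n]}) :
  admissible P f -> forall I, NPI P I = nonvanishing f I.
Proof.
move=> adm I; apply/setP => j; rewrite !inE; apply/asboolP/idP.
- move=> [x []]; rewrite -adm => -[c [c0 c1 xE]] xI.
  set V := [seq _ | m <- _] in c c0 c1 xE.
  have szV : size V = size (msupp (f j)) by rewrite size_map.
  have [i ci] : exists i, c i != 0.
    apply: contrapT => nc; move: c1; rewrite big1 => [/esym/eqP|i _].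
      by rewrite oner_eq0.
    by apply/eqP; apply: contrapT => /negP ci; apply: nc; exists i.
  pose m := nth 0%MM (msupp (f j)) i.
  have iV : (i < size (msupp (f j)))%N by apply: leq_trans (ltn_ord i) (eq_leq szV).
  have mf : m \in msupp (f j) by apply: mem_nth.
  have Vn (l : 'I_(size V)) k : V`_l 0 k = (nth 0%MM (msupp (f j)) l k)%:R.
    have lV : (l < size (msupp (f j)))%N by apply: leq_trans (ltn_ord l) (eq_leq szV).
    by rewrite (nth_map 0%MM) // mxE.
  have mI : supp_in I m.
    apply/supp_inP => k kI; have := xI k kI; rewrite xE summxE.
    move=> /eqP; rewrite psumr_eq0 => [/allP/(_ i)|l _]; last first.
      by rewrite mxE Vn mulr_ge0 // ler0n.
    rewrite mem_index_enum => /(_ isT); rewrite mxE Vn mulf_eq0 (negPf ci) /=.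
    by rewrite pnatr_eq0 => /eqP.
  apply/eqP => r0; have : m \in msupp (restr I (f j)) by rewrite msupp_restr mI.
  by rewrite r0 msupp0.
- move=> r0; have [m] : exists m, m \in msupp (restr I (f j)).
    case E: (msupp _) => [|m s]; last by exists m; rewrite mem_head.
    by move: r0; rewrite -msupp_eq0 E.
  rewrite msupp_restr => /andP[/supp_inP mI mf].
  exists (\row_i (m i)%:R); split; last by move=> i /mI h; rewrite mxE h.
  rewrite -adm /newton_polytope; set V := [seq _ | m <- _].
  have iV : (index m (msupp (f j)) < size V)%N by rewrite size_map index_mem.
  exists (fun i => (i == Ordinal iV)%:R); split.
  + by move=> i; rewrite ler0n.
  + by rewrite (bigD1 (Ordinal iV)) //= eqxx big1 ?addr0 // => i /negPf ->.
  + rewrite (bigD1 (Ordinal iV)) //= eqxx big1 ?addr0 => [|i /negPf ->]; last exact: scale0r.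
    by rewrite scale1r (nth_map 0%MM) ?index_mem // nth_index.
Qed.

Lemma mmap1_supp (S : comNzRingType) n (h h' : 'I_n -> S) (I : {set 'I_n}) m :
  {in I, h =1 h'} -> supp_in I m -> mmap1 h m = mmap1 h' m.
Proof.
move=> hh' /supp_inP mI; apply: eq_bigr => i _.
by have [/hh' ->|/mI ->] := boolP (i \in I).
Qed.

Lemma mmap1_supp0 (S : comNzRingType) n (h : 'I_n -> S) (m : 'X_{1..n}) i :
  h i = 0 -> m i != 0%N -> mmap1 h m = 0.
Proof. by move=> hi mi; rewrite /mmap1 (bigD1 i) //= hi expr0n (negPf mi) mul0r. Qed.

(** * The place of K(t) at t = 0 *)

Section PolynomialPlace.
Variable K : closedFieldType.

Local Notation L := {fraction {poly K}}.

Definition constL : {rmorphism K -> L} := @FracField.tofrac {poly K} \o polyC.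
Definition tL : L := @FracField.tofrac {poly K} 'X.

(** Defined on K[t] only; this is all that is evaluated below. *)
Definition eval0 (x : L) (c : K) : Prop :=
  exists P : {poly K}, x = @FracField.tofrac {poly K} P /\ c = P.[0].

Lemma eval0_place : partial_place constL eval0.
Proof.
split.
- by move=> c; exists c%:P; rewrite hornerC.
- by move=> _ _ _ _ [P [-> ->]] [Q [-> ->]]; exists (P + Q); rewrite hornerD rmorphD.
- by move=> _ _ _ _ [P [-> ->]] [Q [-> ->]]; exists (P * Q); rewrite hornerM rmorphM.
- move=> [P [/esym/eqP]]; rewrite tofrac_eq0 => /eqP -> /eqP.
  by rewrite horner0 oner_eq0.
Qed.

Lemma tL_neq0 : tL != 0. Proof. by rewrite tofrac_eq0 polyX_eq0. Qed.

Lemma eval0_pos c (k : int) : 0 < k -> eval0 (constL c * tL ^ k) 0.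
Proof.
case: k => // -[|k] // _; exists (c%:P * 'X ^+ k.+1 : {poly K}).
by rewrite rmorphM rmorphXn hornerM hornerXn expr0n mulr0.
Qed.

End PolynomialPlace.

Lemma mmap1_monomial (S : fieldType) n (c h : 'I_n -> S) (t : S) (w : 'I_n -> int)
    (I : {set 'I_n}) m : t != 0 -> {in I, forall i, h i = c i * t ^ w i} -> supp_in I m ->
  mmap1 h m = mmap1 c m * t ^ weight_of I w m.
Proof.
move=> t0 hh mI; rewrite (mmap1_supp hh mI) /mmap1.
under eq_bigr do rewrite exprMn.
rewrite big_split /=; congr (_ * _); rewrite /weight_of.
under [in RHS]eq_bigr do rewrite -mulr_natr.
have -> : \sum_(i in I) w i * (m i)%:R = \sum_i w i * (m i)%:R.
  rewrite big_mkcond; apply: eq_bigr => i _; case: ifP => // /negbT.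
  by move=> /(supp_inP _ _ mI) ->; rewrite mulr0.
elim/big_rec2: _ => [|i x y _ ->]; first by rewrite expr0z.
by rewrite expfzDr // -exprz_exp natz -exprnP.
Qed.

(** * Extending a degeneracy by some coordinates *)

Section ExtensionStep.
Variables (K : closedFieldType) (n m : nat) (f : 'I_m -> {mpoly K[n]}).
Variables (I J : {set 'I_n}) (w : 'I_n -> int) (a : 'I_n -> K).
Hypotheses (IJ : I \subset J) (leNJ : (#|nonvanishing f J| <= #|J|)%N)
  (ltNI : (#|I| < #|nonvanishing f I|)%N).
Hypotheses (a0 : forall i, a i != 0) (az : forall j, (In I w (restr I (f j))).@[a] = 0).

Local Notation L := {fraction {poly K}}.
Local Notation A := {mpoly L[n]}.

(** The values of the x_i at the origin y = 0, that is, 0 for i outside I. *)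
Let x (i : 'I_n) : L := if i \in I then constL K (a i) * tL K ^ w i else 0.
Let s (i : 'I_n) : A := if i \in I then (x i)%:MP else 'X_i.
Let kappa : {rmorphism K -> A} := @mpolyC n L \o constL K.
Let g (j : 'I_m) : A := mmap kappa s (restr J (f j)).

Let constM (p q : A) : (p * q)@_0%MM = p@_0%MM * q@_0%MM.
Proof. exact: rmorphM. Qed.

Let s_const i : (s i)@_0%MM = x i.
Proof.
rewrite /s; case: ifP => iI; first by rewrite mcoeffC eqxx mulr1.
by rewrite mcoeffX mnm1_eq0 /x iI.
Qed.

Let smonom_const d : (mmap1 s d)@_0%MM = mmap1 x d.
Proof.
rewrite /mmap1 rmorph_prod; apply: eq_bigr => i _.
by rewrite rmorphXn /= s_const.
Qed.

Let xmonom_eq0 d : ~~ supp_in I d -> mmap1 x d = 0.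
Proof.
by move=> /supp_inPn[i iI di]; rewrite (mmap1_supp0 (i := i)) // /x (negPf iI).
Qed.

Let x_neq0 i : i \in I -> x i != 0.
Proof.
by move=> iI; rewrite /x iI mulf_neq0 ?fmorph_eq0 // expfz_neq0 ?tL_neq0.
Qed.

Let xmonomE d : supp_in I d -> mmap1 x d = constL K (mmap1 a d) * tL K ^ weight_of I w d.
Proof.
move=> dI; rewrite (mmap1_monomial (c := constL K \o a) (tL_neq0 K) (w := w) (I := I)) //.
  congr (_ * _); rewrite /mmap1 rmorph_prod; apply: eq_bigr => i _.
  by rewrite rmorphXn.
by move=> i iI; rewrite /x iI.
Qed.

Let g_const j : j \notin nonvanishing f I -> (g j)@_0%MM = 0.
Proof.
rewrite inE negbK => /eqP fI; rewrite /g /mmap raddf_sum big_seq big1 // => d.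
rewrite msupp_restr => /andP[dJ df].
rewrite -[LHS]/((_ * _)@_0%MM) constM smonom_const xmonom_eq0 ?mulr0 //.
apply/negP => dI; have : d \in msupp (restr I (f j)) by rewrite msupp_restr dI.
by rewrite fI msupp0.
Qed.

(** The variables outside J \ I are added as equations, so that the number of unknowns
    can be taken to be n. *)
Let eqs : seq A := [seq g j | j <- enum (nonvanishing f J :\: nonvanishing f I)] ++
                   [seq 'X_i | i <- enum (~: (J :\: I))].

Let size_eqs : (size eqs < n)%N.
Proof.
rewrite size_cat !size_map -!cardE [X in (_ + X)%N]cardsCs finset.setCK card_ord.
have NIJ : nonvanishing f I \subset nonvanishing f J.
  apply/fintype.subsetP => j; rewrite !inE; apply: contra => /eqP fJ.
  by rewrite (restr_eq0S IJ fJ).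
rewrite cardsD (finset.setIidPr NIJ) cardsD (finset.setIidPr IJ).
have leN := subset_leq_card NIJ; have := subset_leq_card IJ.
have leJ : (#|J| <= n)%N by rewrite -[X in (_ <= X)%N]card_ord max_card.
move: leNJ ltNI leN leJ.
move: #|nonvanishing f J| #|nonvanishing f I| #|J| #|I| => p q r t; lia.
Qed.

(** The set I' consists of I and of the i with y_i <> 0 on a branch through the origin of
    the zero set of the equations.  The place sends a polynomial in y to the value at
    t = 0 of its constant term. *)
Lemma extension_step : exists (I' : {set 'I_n}) (u : 'I_n -> int) (b : 'I_n -> K),
  [/\ I \proper I', I' \subset J,
      forall i, i \in I -> sgz (u i) = sgz (w i), forall i, i \in I' :\: I -> 0 < u i &
      (forall i, b i != 0) /\ forall j, (In I' u (restr I' (f j))).@[b] = 0].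
Proof.
have [|F [phi [phi0 phiK [i0 Xi0]]]] := branch_through_origin
    (g := fun k : 'I_(size eqs) => eqs`_k) _ size_eqs.
  move=> k; have := mem_nth 0 (ltn_ord k); move: (eqs`_k) => q.
  rewrite mem_cat => /orP[/mapP[j]|/mapP[i _ ->]]; last by rewrite mcoeffX mnm1_eq0.
  by rewrite mem_enum inE => /andP[jI _] ->; apply: g_const.
have {}phi0 q : q \in eqs -> phi q = 0.
  by move=> qe; rewrite -(nth_index 0 qe); have := phi0 (Ordinal (etrans (index_mem q eqs) qe)).
have XJ i : i \notin J :\: I -> phi 'X_i = 0.
  move=> iJ; apply: phi0; rewrite mem_cat; apply/orP; right.
  by apply/mapP; exists i; rewrite // mem_enum inE.
pose Y := [set i in J :\: I | phi 'X_i != 0]; pose I' := I :|: Y.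
have YJ : Y \subset J :\: I by apply/fintype.subsetP => i; rewrite inE => /andP[].
have I'J : I' \subset J by rewrite finset.subUset IJ (fintype.subset_trans YJ) // finset.subsetDl.
have II' : I \subset I' by apply: finset.subsetUl.
pose iota : {rmorphism K -> F} := phi \o kappa.
pose Phi (v : F) (c : K) := exists q : A, v = phi q /\ eval0 (q@_0%MM) c.
have E0 := eval0_place K.
have PhiP : partial_place iota Phi.
  split.
  - by move=> c; exists (kappa c); split=> //; rewrite mcoeffC eqxx mulr1; apply: (placeC E0).
  - move=> _ _ c d [p [-> hp]] [q [-> hq]]; exists (p + q).
    by rewrite rmorphD mcoeffD; split=> //; apply: (placeD E0).
  - move=> _ _ c d [p [-> hp]] [q [-> hq]]; exists (p * q).
    by rewrite rmorphM constM; split=> //; apply: (placeM E0).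
  - by move=> [q [/esym/phiK ->]]; apply: (place01 E0).
pose z i := if i \in I' then phi (s i) else 1.
have zI i : i \in I -> z i = phi (x i)%:MP.
  by move=> iI; rewrite /z /s (fintype.subsetP II') // iI.
have zY i : i \in Y -> z i = phi 'X_i.
  move=> iY; rewrite /z /s inE iY orbT.
  by move: iY; rewrite !inE => /andP[/andP[/negPf -> _]].
have phiC c : c != 0 -> phi c%:MP != 0 by move=> c0; rewrite (fmorph_eq0 (phi \o @mpolyC n L)).
have z0 i : z i != 0.
  have [iI|iI] := boolP (i \in I'); last by rewrite /z (negPf iI) oner_neq0.
  have := iI; rewrite inE => /orP[iI1|iY]; first by rewrite zI // phiC // x_neq0.
  by rewrite zY //; move: iY; rewrite inE => /andP[].
have zmonom d : supp_in I' d -> mmap1 z d = phi (mmap1 s d).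
  move=> dI; rewrite (mmap1_supp (h' := phi \o s) _ dI) => [|i iI]; last by rewrite /z iI.
  by rewrite /mmap1 rmorph_prod; apply: eq_bigr => i _; rewrite rmorphXn.
have zmonomI d : supp_in I d -> mmap1 z d = phi (mmap1 x d)%:MP.
  move=> dI; rewrite (mmap1_supp (h' := phi \o @mpolyC n L \o x) _ dI) => [|i iI]; last exact: zI.
  by rewrite /mmap1 !rmorph_prod; apply: eq_bigr => i _; rewrite !rmorphXn.
have phig j : phi (g j) = mmap iota z (restr I' (f j)).
  rewrite /g !mmap_restr rmorph_sum big_mkcond [RHS]big_mkcond; apply: eq_bigr => d _.
  case: ifP => [dJ|/negbT dJ]; last first.
    by case: ifP => // /(supp_inS I'J) dJ'; rewrite dJ' in dJ.
  rewrite rmorphM; case: ifP => [/zmonom -> //|/negbT/supp_inPn[i iI' di]].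
  suff -> : phi (mmap1 s d) = 0 by rewrite mulr0.
  have -> : phi (mmap1 s d) = mmap1 (phi \o s) d.
    by rewrite /mmap1 rmorph_prod; apply: eq_bigr => k _; rewrite rmorphXn.
  have iJ : i \in J by apply: contraNT di => iJ; rewrite (supp_inP _ _ dJ).
  apply: mmap1_supp0 di => /=.
  move: iI'; rewrite !inE iJ negb_or /s => /andP[/negPf ->] /=.
  by rewrite negbK => /eqP.
have phiCV c : phi (c^-1)%:MP = (phi c%:MP)^-1 by rewrite -[LHS]/((phi \o @mpolyC n L) _) fmorphV.
have [|u [b [b0 sgn bz]]] := place_initial_zero PhiP z0 (p := fun j => restr I' (f j)).
  move=> j pj0; have [jI|jI] := boolP (j \in nonvanishing f I); last first.
    have [d dp] : exists d, d \in msupp (restr I' (f j)).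
      case E: (msupp _) => [|d T]; last by exists d; rewrite mem_head.
      by move: pj0; rewrite -msupp_eq0 E.
    exists d => //; rewrite -phig phi0 ?mul0r; first exact: (place0 PhiP).
    rewrite mem_cat map_f // mem_enum finset.in_setD jI inE.
    by apply: contra pj0 => /eqP/(restr_eq0S I'J) ->.
  have [d0 d0p] : exists d, d \in msupp (restr I (f j)).
    case E: (msupp _) => [|d T]; last by exists d; rewrite mem_head.
    by move: jI; rewrite inE -msupp_eq0 E.
  (* Terms of f_j that involve Y vanish at y = 0; the remaining ones, divided by
     x^d1 with d1 of least weight, give In_w(f_j)(a) / a^d1 at t = 0. *)
  have [d1 d1p d1min] := seq_minimum (weight_of I w) d0p.
  have := d1p; rewrite msupp_restr => /andP[d1I d1f].
  exists d1; first by rewrite msupp_restr (supp_inS II' d1I).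
  pose val d := if supp_in I d && (weight_of I w d == weight_of I w d1)
                then (f j)@_d * (mmap1 a d / mmap1 a d1) else 0.
  have -> : 0 = \sum_(d <- msupp (f j) | supp_in I' d) val d.
    have := az j; rewrite /In (perm_big _ (perm_msupp_restr I (f j))) big_filter_cond.
    rewrite raddf_sum /= => e; have := congr1 (fun v => v / mmap1 a d1) e.
    rewrite /= mul0r => h; apply: etrans (esym h) _; rewrite mulr_suml big_mkcond [RHS]big_mkcond.
    rewrite big_seq [RHS]big_seq; apply: eq_bigr => d df; rewrite /val.
    case: (boolP (supp_in I d)) => [dI|_]; last by rewrite if_same.
    rewrite (supp_inS II' dI) /= mcoeff_restr dI.
    have -> : all (fun d' => weight_of I w d <= weight_of I w d') (msupp (restr I (f j))) =
              (weight_of I w d == weight_of I w d1).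
      have dr : d \in msupp (restr I (f j)) by rewrite msupp_restr dI.
      rewrite eq_le d1min // andbT; apply/allP/idP => [|le k /d1min]; first exact.
      exact: le_trans.
    by case: ifP => // _; rewrite mevalZ mevalX mulrA.
  rewrite mmap_restr mulr_suml big_seq_cond [X in Phi _ X]big_seq_cond.
  apply: (place_sum PhiP) => d /andP[df dI'].
  exists (kappa (f j)@_d * (mmap1 s d * (mmap1 x d1)^-1%:MP)); split.
    by rewrite !rmorphM phiCV -zmonomI // -zmonom // mulrA.
  rewrite !constM smonom_const -[kappa _]/((constL K _)%:MP) !mcoeffC eqxx !mulr1 /val.
  have [dI|dI] := boolP (supp_in I d); last first.
    by rewrite xmonom_eq0 // mul0r mulr0; apply: (place0 E0).
  have -> : mmap1 x d / mmap1 x d1 =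
      constL K (mmap1 a d / mmap1 a d1) * tL K ^ (weight_of I w d - weight_of I w d1).
    rewrite !xmonomE // fmorph_div expfzDr ?tL_neq0 // -invr_expz invfM.
    by rewrite mulrACA.
  rewrite [X in eval0 X _]mulrA -(rmorphM (constL K)) andTb; case: eqP => [->|/eqP ne].
    by rewrite subrr expr0z mulr1; apply: (placeC E0).
  apply: eval0_pos; rewrite subr_gt0 lt_neqAle eq_sym ne d1min //.
  by rewrite msupp_restr dI.
have PhiC (v : L) c : eval0 v c -> Phi (phi v%:MP) c.
  by exists v%:MP; rewrite mcoeffC eqxx mulr1.
exists I', u, b; split=> //.
- rewrite properE II'; apply/fintype.subsetPn; exists i0.
    have i0J : i0 \in J :\: I by apply: contraNT Xi0 => /XJ ->.
    by rewrite !inE Xi0 andbT orbC -finset.in_setD i0J.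
  by apply: contraNN Xi0 => i0I; rewrite XJ // inE i0I.
- move=> i iI; have [sp sn s0] := sgn i; rewrite zI // in sp sn s0.
  have xi : x i = constL K (a i) * tL K ^ w i by rewrite /x iI.
  have [wi|wi|wi] := ltrgtP (w i) 0.
  + rewrite !ltr0_sgz // sn // -phiCV; apply: PhiC.
    rewrite xi invfM invr_expz -fmorphV; apply: eval0_pos.
    by rewrite oppr_gt0.
  + by rewrite !gtr0_sgz // sp //; apply: PhiC; rewrite xi; apply: eval0_pos.
  + rewrite (s0 (a i)) ?wi //; apply: PhiC; rewrite xi wi expr0z mulr1.
    exact: (placeC E0).
- move=> i iY; have {}iY : i \in Y by move: iY; rewrite !inE; case: (i \in I).
  have [sp _ _] := sgn i; apply: sp; rewrite zY //; exists 'X_i; split=> //.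
  by rewrite mcoeffX mnm1_eq0; apply: (place0 E0).
- split=> // j; rewrite -[RHS](bz j); congr (_.@[_]).
  have wE d : weight_of I' u d = weight_of [set: 'I_n] u d.
    rewrite /weight_of big_mkcond [RHS]big_mkcond; apply: eq_bigr => i _.
    rewrite finset.in_setT; case: ifP => // /negbT iI'; have [_ _ s0] := sgn i.
    rewrite (s0 1) ?mul0rn ?oner_neq0 // /z (negPf iI').
    exact: (place1 PhiP).
  rewrite /In; apply: eq_bigl => d; apply: eq_all => d'; by rewrite !wE.
Qed.

End ExtensionStep.

(** * Transfer of non-degeneracy between coordinate subspaces *)

Section Degeneracy.
Variables (K : closedFieldType) (n m : nat) (f : 'I_m -> {mpoly K[n]}).
Implicit Types (I J : {set 'I_n}) (w u : 'I_n -> int) (p : {mpoly K[n]}).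

Definition torus_zero (g : 'I_m -> {mpoly K[n]}) : Prop :=
  exists2 x, torus [set: 'I_n] x & common_zero g x.

Lemma torus_zeroP (g : 'I_m -> {mpoly K[n]}) :
  torus_zero g <-> exists a : 'I_n -> K, (forall i, a i != 0) /\ forall j, (g j).@[a] = 0.
Proof.
split=> [[x [_ x0] gx]|[a [a0 ga]]]; first by exists x; split=> // i; apply: x0; rewrite inE.
by exists a => //; split=> [i|i _ //]; rewrite inE.
Qed.

(** Iteration of the extension step: every I' strictly between I and J satisfies its
    hypothesis |N^I'| > |I'|. *)
Lemma degeneracy_extends I J w :
    I \subset J -> (#|nonvanishing f J| <= #|J|)%N ->
    (forall I', I \subset I' -> I' \proper J -> (#|I'| < #|nonvanishing f I'|)%N) ->
    torus_zero (fun j => In I w (restr I (f j))) ->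
  exists u, [/\ forall i, i \in I -> sgz (u i) = sgz (w i),
    forall i, i \in J :\: I -> 0 < u i & torus_zero (fun j => In J u (restr J (f j)))].
Proof.
have [k] := ubnP (#|J| - #|I|); elim: k I w => // k IH I w; rewrite ltnS => lek IJ leNJ lt_between.
move=> /[dup] zero /torus_zeroP[a [a0 az]].
have [IJp|] := boolP (I \proper J); last first.
  rewrite finset.properEneq IJ andbT negbK => /eqP IJe; exists w; split; first by [].
    by move=> i; rewrite IJe finset.setDv inE.
  by rewrite -IJe.
have ltNI := lt_between I (subxx _) IJp.
have [I' [u [b [II' I'J sgu posu [b0 bz]]]]] := extension_step IJ leNJ ltNI a0 az.
have [|I'' I''s I''p||v [sgv posv vz]] := IH I' u _ I'J leNJ.
- have := proper_card II'; have := proper_card IJp; have := subset_leq_card I'J.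
  move: lek; move: #|I| #|J| #|I'| => p q r; lia.
- by apply: lt_between I''p; apply: fintype.subset_trans (proper_sub II') I''s.
- by apply/torus_zeroP; exists b.
exists v; split=> // i.
  by move=> iI; rewrite sgv ?sgu // (fintype.subsetP (proper_sub II')).
rewrite inE => /andP[iI iJ]; have [iI'|iI'] := boolP (i \in I'); last first.
  by apply: posv; rewrite inE iI'.
by rewrite -sgz_gt0 sgv // sgz_gt0 posu // inE iI.
Qed.

Lemma In_scale J u u' (d : int) p : 0 < d -> {in J, forall i, u i = d * u' i} ->
  In J u p = In J u' p.
Proof.
move=> d0 uE; have wE k : weight_of J u k = d * weight_of J u' k.
  by rewrite /weight_of mulr_sumr; apply: eq_bigr => i /uE ->; rewrite mulrnAr.
by apply: eq_bigl => k; apply: eq_all => l; rewrite !wE ler_pM2l.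
Qed.

Lemma Ld_opp J w p : Ld J w p = In J (fun i => - w i) p.
Proof.
have wE k : weight_of J (fun i => - w i) k = - weight_of J w k.
  by rewrite /weight_of -sumrN; apply: eq_bigr => i _; rewrite mulNrn.
by apply: eq_bigl => k; apply: eq_all => l; rewrite !wE lerN2.
Qed.

Lemma weights_gcdN J w : weights_gcd J (fun i => - w i) = weights_gcd J w.
Proof. by apply: eq_bigr => i _; rewrite abszN. Qed.

Lemma primitive_weights J u i0 : i0 \in J -> u i0 != 0 ->
  exists u', [/\ weights_gcd J u' = 1%N, {in J, forall i, sgz (u' i) = sgz (u i)} &
    forall p : {mpoly K[n]}, In J u p = In J u' p].
Proof.
move=> i0J ui0; pose d := weights_gcd J u.
have dvd_d i : i \in J -> (d %| `|u i|)%N.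
  by move=> iJ; rewrite /d /weights_gcd (bigD1 i) //= dvdn_gcdl.
have d0 : (0 < d)%N.
  by rewrite lt0n; apply: contraNneq ui0 => e; have := dvd_d i0 i0J; rewrite e dvd0n absz_eq0.
exists (fun i => (u i %/ d)%Z).
have uE : {in J, forall i, u i = d%:Z * (u i %/ d)%Z}.
  by move=> i iJ; rewrite mulrC divzK //; apply: dvd_d.
split.
- apply/eqP; rewrite -(eqn_pmul2l d0) muln1 {2}/d /weights_gcd.
  rewrite (big_morph (muln d) (muln_gcdr d) (muln0 d)).
  by apply/eqP; apply: eq_bigr => i iJ; rewrite [in RHS]uE // abszM absz_nat.
- by move=> i iJ; rewrite [in RHS]uE // sgzM (gtr0_sgz (x := d%:Z) d0) mul1r.
- by move=> p; apply: In_scale uE.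
Qed.

Lemma primitive_degeneracy I J w :
    I \proper J -> (#|nonvanishing f J| <= #|J|)%N ->
    (forall I', I \subset I' -> I' \proper J -> (#|I'| < #|nonvanishing f I'|)%N) ->
    torus_zero (fun j => In I w (restr I (f j))) ->
  exists u, [/\ weights_gcd J u = 1%N, forall i, i \in I -> sgz (u i) = sgz (w i),
    forall i, i \in J :\: I -> 0 < u i & torus_zero (fun j => In J u (restr J (f j)))].
Proof.
move=> IJ leNJ lt_between zero.
have [u [sgu posu uz]] := degeneracy_extends (proper_sub IJ) leNJ lt_between zero.
have /properP[_ [i0 i0J i0I]] := IJ.
have ui0 : 0 < u i0 by apply: posu; rewrite inE i0I.
have [u' [gcd1 sgu' InE]] := primitive_weights i0J (lt0r_neq0 ui0).
exists u'; split.
- exact: gcd1.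
- by move=> i iI; rewrite sgu' ?sgu // (fintype.subsetP (proper_sub IJ)).
- by move=> i iJI; rewrite -sgz_gt0 sgu' ?sgz_gt0 ?posu //; move: iJI; rewrite inE => /andP[].
- by case: uz => x tx zx; exists x; [exact: tx | move=> j; rewrite -InE; apply: zx].
Qed.

Section Transfer.
Variables (I J : {set 'I_n}).
Hypotheses (IJ : I \proper J) (leNJ : (#|nonvanishing f J| <= #|J|)%N).
Hypothesis lt_between :
  forall I', I \subset I' -> I' \proper J -> (#|I'| < #|nonvanishing f I'|)%N.

(** Only the signs of the weights matter for being centered at infinity, with
    Ld_w = In_(-w). *)
Lemma nondeg_infinity_transfer :
  BKK_nondeg_infinity J (fun j => restr J (f j)) ->
  BKK_nondeg_infinity I (fun j => restr I (f j)).
Proof.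
move=> nondeg w [_ [i iI wi]] [x tx zx].
have [|u [gcd1 sgu _ [y ty zy]]] := primitive_degeneracy (w := fun i => - w i) IJ leNJ lt_between.
  by exists x; [exact: tx | move=> j; rewrite -Ld_opp; apply: zx].
apply: (nondeg (fun i => - u i)).
  split; first by rewrite weights_gcdN.
  exists i; first exact: (fintype.subsetP (proper_sub IJ)).
  by rewrite oppr_gt0 -sgz_lt0 sgu // sgz_lt0 oppr_lt0.
exists y; first exact: ty.
move=> j; rewrite Ld_opp; have -> : (fun i => - - u i) = u.
  by apply: boolp.funext => k; rewrite opprK.
exact: zy.
Qed.

(** The weights obtained on J vanish on the same S, and are positive on J \ S. *)
Lemma nondeg_at_transfer (C C' : {set {set 'I_n}}) :
  (forall S, S \in C -> S \subset I /\ S \in C') ->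
  BKK_nondeg_at J C' (fun j => restr J (f j)) ->
  BKK_nondeg_at I C (fun j => restr I (f j)).
Proof.
move=> CC' nondeg w _ [S /CC'[SI SC'] [w0 wpos]] zero.
have [u [gcd1 sgu posu uz]] := primitive_degeneracy IJ leNJ lt_between zero.
apply: (nondeg u) uz; first by right.
exists S => //; split=> [s sS|s].
  by apply/eqP; rewrite -sgz_eq0 sgu ?w0 ?sgz0 // (fintype.subsetP SI).
rewrite inE => /andP[sS sJ]; have [sI|sI] := boolP (s \in I).
  by rewrite -sgz_gt0 sgu // sgz_gt0 wpos // inE sS.
by apply: posu; rewrite inE sI.
Qed.

End Transfer.
End Degeneracy.

Lemma minimal_tight_superset n (N : {set 'I_n} -> {set 'I_n}) (I : {set 'I_n}) :
  exists J : {set 'I_n}, [/\ I \subset J, (#|N J| <= #|J|)%N &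
    forall I' : {set 'I_n}, I \subset I' -> I' \proper J -> (#|I'| < #|N I'|)%N].
Proof.
pose P (J : {set 'I_n}) := (I \subset J) && (#|N J| <= #|J|)%N.
have PT : P [set: 'I_n] by rewrite /P finset.subsetT cardsT max_card.
case: (arg_minnP (fun J : {set 'I_n} => #|J|) PT) => J /andP[IJ NJ] minJ.
exists J; split=> // I' II' I'J; rewrite ltnNge; apply/negP => le.
have := minJ I'; rewrite /P II' le => /(_ isT).
by rewrite leqNgt proper_card.
Qed.

Lemma down_closureS n (SS : {set {set 'I_n}}) (I J : {set 'I_n}) :
  I \subset J -> I \notin down_closure SS -> J \notin down_closure SS.
Proof.
rewrite !inE => IJ; apply: contra => /exists_inP[S SSS JS].
by apply/exists_inP; exists S => //; apply: fintype.subset_trans JS.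
Qed.

(** * The equivalence *)

Theorem lemma6p19 (R : realType) (K : closedFieldType) (n : nat)
    (hn : (0 < n)%N)
    (P : 'I_n -> set 'rV[R]_n)
    (hP : forall j, integral_polytope (P j))
    (hP0 : forall j, (P j `<=` nonneg_orthant)%classic)
    (SS : {set {set 'I_n}})
    (f : 'I_n -> {mpoly K[n]}) :
  nondegenerate_on P SS f <->
  [/\ admissible P f,
      forall I, I \in NSP K P SS ->
        BKK_nondeg_infinity I (fun j => restr I (f j)) /\
        BKK_nondeg_at I (subsets_in (down_closure SS :|: TT K P SS) I)
          (fun j => restr I (f j))
    & forall I, I \in TTstar K P SS ->
        BKK_nondeg_at I (subsets_in (TT' K P SS) I)
          (fun j => restr I (f j))].
Proof.
split=> [[adm condT' condT]|[adm condN condTs]].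
  split=> // I; first by rewrite inE => /andP[/condT'].
  by rewrite inE => /andP[/condT].
have NE := NPI_nonvanishing adm.
have inES (I J : {set 'I_n}) : I \subset J -> in_E P J -> in_E P I.
  by move=> IJ [M [JM lt]]; exists M; split=> //; apply: fintype.subset_trans JM.
have sub_in (C : {set {set 'I_n}}) (I J : {set 'I_n}) : I \subset J ->
    forall S, S \in subsets_in C I -> S \subset I /\ S \in subsets_in C J.
  move=> IJ S; rewrite !inE => /andP[SC SI]; split=> //.
  by rewrite SC (fintype.subset_trans SI).
split=> // I.
- move=> /[dup] IT'; rewrite inE => /andP[IS /asboolPn nexo].
  have [trI|ntrI] := EM (torus_trivial K P I); last first.
    by apply: condN; rewrite inE IT'; apply/asboolPn.
  have nE : ~ in_E P I by move=> IE; apply: nexo; left.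
  have [J [IJ leNJ lt_between]] := minimal_tight_superset (NPI P) I.
  have eqNJ : #|NPI P J| = #|J|.
    by apply/eqP; rewrite eqn_leq leNJ leqNgt; apply/negP => lt; apply: nE; exists J.
  have ntrJ : ~ torus_trivial K P J.
    by move=> trJ; apply: nexo; right; split=> //; exists J.
  have nexoJ : ~ exotrivial K P J by move=> [/(inES _ _ IJ) //|[]].
  have JN : J \in NSP K P SS.
    rewrite !inE; apply/andP; split; last exact/asboolPn.
    by apply/andP; split; [have := down_closureS IJ IS; rewrite inE | apply/asboolPn].
  have IJp : I \proper J.
    by rewrite finset.properEneq IJ andbT; apply/eqP => e; apply: ntrJ; rewrite -e.
  have [infJ atJ] := condN J JN.
  rewrite NE in leNJ; have {}lt_between (I' : {set 'I_n}) : I \subset I' -> I' \proper J ->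
      (#|I'| < #|nonvanishing f I'|)%N by rewrite -NE; apply: lt_between.
  split; first exact: nondeg_infinity_transfer infJ.
  by apply: nondeg_at_transfer atJ => //; apply: sub_in.
- move=> /[dup] IT; rewrite inE => /andP[IS /asboolP exo].
  have [eqNI|neNI] := eqVneq #|NPI P I| #|I|.
    by apply: condTs; rewrite inE IT; apply/eqP.
  have [[S0 S0T']|noS] := EM (exists S, S \in subsets_in (TT' K P SS) I); last first.
    by move=> w _ [S ST']; case: noS; exists S.
  have nE : ~ in_E P I.
    move: S0T'; rewrite !inE => /andP[/andP[_ /asboolPn nexoS] SI] IE.
    by apply: nexoS; left; apply: inES IE.
  case: exo => // -[trI [J [IJ trJ eqNJ lt_between]]].
  have IJp : I \proper J.
    by rewrite finset.properEneq IJ andbT; apply: contraNneq neNI => e; rewrite e eqNJ.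
  have JT : J \in TTstar K P SS.
    rewrite !inE eqNJ eqxx andbT; apply/andP; split.
      by have := down_closureS IJ IS; rewrite inE.
    apply/asboolP; right; split=> //; exists J; split=> // I' JI' I'J.
    by have := fintype.subset_trans JI' (proper_sub I'J); have := proper_subn I'J; rewrite JI'.
  have leNJ : (#|nonvanishing f J| <= #|J|)%N by rewrite -NE eqNJ.
  have {}lt_between (I' : {set 'I_n}) : I \subset I' -> I' \proper J ->
      (#|I'| < #|nonvanishing f I'|)%N by rewrite -NE; apply: lt_between.
  by apply: nondeg_at_transfer (condTs J JT) => //; apply: sub_in.
Qed.
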